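(* Let $(M,\rho,\lambda,\mu)$ be a bimodule-algebra over a braided set $(X,\sigma)$. For $p,q\ge 0$ and maps $f\colon X^{\times p}\to M$, $g\colon X^{\times q}\to M$, define $f\smile g\colon X^{\times(p+q)}\to M$ by $$f\smile g=\sum_{s\in Sh_{p,q}}(-1)^{|s|}\,\mu\,(f\times g)\,T_{s^{-1}},$$ where $(f\times g)(x_1,\ldots,x_{p+q})=(f(x_1,\ldots,x_p),g(x_{p+1},\ldots,x_{p+q}))$. Then $\smile$ turns $\big(\bigoplus_{k\ge0}\mathrm{Map}(X^{\times k},M),d^k\big)$ into a differential graded associative algebra; in particular $d^{p+q+1}(f\smile g)=d^{p+1}(f)\smile g+(-1)^pf\smile d^{q+1}(g)$. It induces an associative product, also denoted $\smile$, on $H^*(X,\sigma;M)=\bigoplus_{k\ge0}H^k(X,\sigma;M)$. Moreover, if $\Bbbk$ is a commutative ring with trivial $(X,\sigma)$-actions, then the product $\smile$ on $H^*(X,\sigma;\Bbbk)$ is graded commutative: for all cocycles $f\colon X^{\times p}\to\Bbbk$, $g\colon X^{\times q}\to\Bbbk$, $$[f]\smile[g]=(-1)^{pq}\,[g]\smile[f].$$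
   Context: A braided set $(X,\sigma)$ is a set $X$ with a (not necessarily invertible) map $\sigma\colon X^{\times 2}\to X^{\times 2}$ satisfying $(\sigma\times \mathrm{Id})(\mathrm{Id}\times\sigma)(\sigma\times \mathrm{Id})=(\mathrm{Id}\times\sigma)(\sigma\times \mathrm{Id})(\mathrm{Id}\times\sigma)$ on $X^{\times 3}$. Let $b_i$ ($1\le i\le k-1$) act on $X^{\times k}$ by $\mathrm{Id}^{\times(i-1)}\times\sigma\times \mathrm{Id}^{\times(k-i-1)}$ (an action of the positive braid monoid); in products, the rightmost factor acts first. Words of length $k$ in $X$ are identified with elements of $X^{\times k}$. For $s\in S_k$ with a shortest expression $s=s_{i_1}\cdots s_{i_t}$ in the adjacent transpositions $s_i=(i\;i+1)$, put $T_s=b_{i_1}\cdots b_{i_t}$ and $|s|=t$. The shuffle set is $Sh_{p,q}=\{s\in S_{p+q}\mid s(1)<\cdots<s(p),\ s(p+1)<\cdots<s(p+q)\}$. A linear bimodule over $(X,\sigma)$ is an abelian group $M$ with maps $\rho\colon M\times X\to M$, $(m,x)\mapsto m\cdot x$ and $\lambda\colon X\times M\to M$, $(x,m)\mapsto x\cdot m$, additive in $m$, such that $(m\cdot x)\cdot y=(m\cdot y')\cdot x'$ and $x\cdot(y\cdot m)=y'\cdot(x'\cdot m)$ whenever $\sigma(x,y)=(y',x')$, and $(x\cdot m)\cdot y=x\cdot(m\cdot y)$. A bimodule-algebra is a linear bimodule with a bilinear associative product $\mu$ satisfying $\mu(x\cdot m_1,m_2)=x\cdot\mu(m_1,m_2)$,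 $\mu(m_1,m_2\cdot x)=\mu(m_1,m_2)\cdot x$, $\mu(m_1\cdot x,m_2)=\mu(m_1,x\cdot m_2)$. Actions are trivial if $m\cdot x=m=x\cdot m$ for all $m,x$. The braided cochain complex is $C^k=\mathrm{Map}(X^{\times k},M)$, $k\ge0$ (with $C^0=M$), with differential $d^k=\sum_{i=1}^k(-1)^{i-1}(d_l^{k;i}-d_r^{k;i})\colon C^{k-1}\to C^k$, $k>0$, where $(d_l^{k;i}f)(x_1,\ldots,x_k)=x'_i\cdot f(x'_1,\ldots,x'_{i-1},x_{i+1},\ldots,x_k)$ with $x'_ix'_1\ldots x'_{i-1}=b_1\cdots b_{i-1}(x_1\ldots x_i)$, and $(d_r^{k;i}f)(x_1,\ldots,x_k)=f(x_1,\ldots,x_{i-1},x''_{i+1},\ldots,x''_k)\cdot x''_i$ with $x''_{i+1}\ldots x''_kx''_i=b_{k-i}\cdots b_1(x_i\ldots x_k)$. $H^k(X,\sigma;M)$ is the $k$-th cohomology group of this complex. (This is known to be a cochain complex.) *)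

(* Defs.v *)
From HB Require Import structures.
From mathcomp Require Import all_boot all_order all_fingroup all_algebra.
From mathcomp Require Import boolp functions.

Set Implicit Arguments.
Unset Strict Implicit.
Unset Printing Implicit Defensive.

Import GRing.Theory.
Local Open Scope ring_scope.

Definition braid12 (X : Type) (sigma : X * X -> X * X) (t : X * X * X) :=
  let: (x, y, z) := t in let: (x', y') := sigma (x, y) in (x', y', z).

Definition braid23 (X : Type) (sigma : X * X -> X * X) (t : X * X * X) :=
  let: (x, y, z) := t in let: (y', z') := sigma (y, z) in (x, y', z').

Record braidedSet := BraidedSet {
  carrier :> Type;
  braiding : carrier * carrier -> carrier * carrier;
  yang_baxter : forall t,
    braid12 braiding (braid23 braiding (braid12 braiding t)) =
    braid23 braiding (braid12 braiding (braid23 braiding t))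
}.

Section Words.
Variable X : braidedSet.

(* Indices of the generators are shifted by one: [bact i] is b_{i+1}, acting  *)
(* on the letters of positions i and i+1 (counted from 0). It is the identity *)
(* when i+1 is not a position of the word.                                    *)
Fixpoint bact_seq (i : nat) (w : seq X) : seq X :=
  match i, w with
  | 0, [:: x, y & t] => let: (y', x') := braiding (x, y) in [:: y', x' & t]
  | i'.+1, x :: t => x :: bact_seq i' t
  | _, _ => w
  end.

Lemma size_bact_seq i w : size (bact_seq i w) = size w.
Proof.
elim: i w => [[|x [|y t]] //=|i IHi [|x t] //=]; last by rewrite IHi.
by case: (braiding _).
Qed.

Lemma bact_subproof k i (w : k.-tuple X) : size (bact_seq i w) == k.
Proof. by rewrite size_bact_seq size_tuple. Qed.

Definition bact k (i : nat) (w : k.-tuple X) : k.-tuple X :=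
  Tuple (bact_subproof i w).

(* the rightmost generator acts first *)
Definition bexpr k (e : seq nat) (w : k.-tuple X) : k.-tuple X :=
  foldr (@bact k) w e.

End Words.

Lemma adj_subproof k (i : 'I_k.-1) : (i.+1 < k)%N.
Proof. by rewrite -ltn_predRL. Qed.

(* the adjacent transposition exchanging the positions i and i+1, from 0 *)
Definition adj k (i : 'I_k.-1) : 'S_k :=
  tperm (widen_ord (leq_pred k) i) (Ordinal (adj_subproof i)).

(* [expr_perm [:: i_1; ...; i_t]] is the composite s_{i_1} o ... o s_{i_t}.   *)
(* The order looks reversed since (s * t) x = t (s x) in {perm _}.            *)
Definition expr_perm k (e : seq 'I_k.-1) : 'S_k :=
  foldr (fun i s => s * adj i)%g 1%g e.

Definition shortest_expr k (s : 'S_k) (e : seq 'I_k.-1) : Prop :=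
  expr_perm e = s /\ forall e', expr_perm e' = s -> (size e <= size e')%N.

Lemma expr_perm_cat k (e1 e2 : seq 'I_k.-1) :
  expr_perm (e1 ++ e2) = (expr_perm e2 * expr_perm e1)%g.
Proof. by elim: e1 => [|i e1 /= ->]; rewrite /= ?mulg1 ?mulgA. Qed.

Lemma expr_perm_tperm k (x y : 'I_k) :
  (x < y)%N -> exists e : seq 'I_k.-1, expr_perm e = tperm x y.
Proof.
case: y => y /= ky; elim: y ky => [//|y IHy] ky; rewrite ltnS leq_eqVlt.
have yk : (y < k.-1)%N by rewrite ltn_predRL.
have adjE : adj (Ordinal yk) = tperm (Ordinal (ltnW ky)) (Ordinal ky).
  by rewrite /adj; congr tperm; apply: val_inj.
case/predU1P => [xy|/(IHy (ltnW ky))[e eE]].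
  exists [:: Ordinal yk]; rewrite /= mul1g adjE; congr tperm.
  by apply: val_inj; rewrite /= xy.
have [->|xy] := eqVneq x (Ordinal (ltnW ky)).
  by exists [:: Ordinal yk]; rewrite /= mul1g adjE.
have [xy1|xy1] := eqVneq x (Ordinal ky).
  by exists [::]; rewrite xy1 tperm1.
exists ([:: Ordinal yk] ++ e ++ [:: Ordinal yk]).
rewrite !expr_perm_cat eE /= mul1g adjE.
rewrite -{1}[tperm (Ordinal (ltnW ky)) _]tpermV -mulgA -conjgE tpermJ tpermL.
by rewrite tpermD // eq_sym.
Qed.

Lemma shortest_expr_exists k (s : 'S_k) : exists e, shortest_expr s e.
Proof.
have [e0 e0s] : exists e : seq 'I_k.-1, expr_perm e = s.
  have [ts -> _] := prod_tpermP s.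
  elim: ts => [|[x y] ts [e IHe]]; first by exists [::]; rewrite big_nil.
  rewrite big_cons -IHe /=.
  have [u <-] : exists u : seq 'I_k.-1, expr_perm u = tperm x y.
    case: (ltngtP x y) => [|lt_yx|/val_inj->]; first exact: expr_perm_tperm.
      by rewrite tpermC; apply: expr_perm_tperm.
    by exists [::]; rewrite tperm1.
  by exists (e ++ u); rewrite expr_perm_cat.
have exP : exists n, `[< exists e : seq 'I_k.-1, expr_perm e = s /\ size e = n >].
  by exists (size e0); apply/asboolP; exists e0.
case: (ex_minnP exP) => n /asboolP[e [es <-]] min_n.
by exists e; split=> // e' e's; apply: min_n; apply/asboolP; exists e'.
Qed.

(* A chosen shortest expression. By Matsumoto's theorem and the Yang-Baxter   *)
(* equation, [permT] below does not depend on the choice.                     *)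
Definition some_expr k (s : 'S_k) : seq 'I_k.-1 :=
  sval (cid (shortest_expr_exists s)).

Definition perm_length k (s : 'S_k) : nat := size (some_expr s).

(* the operator T_s on words of length k *)
Definition permT (X : braidedSet) k (s : 'S_k) (w : k.-tuple X) : k.-tuple X :=
  bexpr (map val (some_expr s)) w.

Definition shuffles p q : {set 'S_(p + q)} :=
  [set s : 'S_(p + q) |
    [forall i : 'I_p, forall j : 'I_p,
       (i < j)%N ==> (s (lshift q i) < s (lshift q j))%N] &&
    [forall i : 'I_q, forall j : 'I_q,
       (i < j)%N ==> (s (rshift p i) < s (rshift p j))%N]].

Record bimodule (X : braidedSet) := Bimodule {
  bimod_sort :> zmodType;
  ract : bimod_sort -> X -> bimod_sort;
  lact : X -> bimod_sort -> bimod_sort;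
  ractD : forall x, {morph ract^~ x : m n / m + n};
  lactD : forall x, {morph lact x : m n / m + n};
  ract_braid : forall m x y x' y', braiding (x, y) = (y', x') ->
    ract (ract m x) y = ract (ract m y') x';
  lact_braid : forall m x y x' y', braiding (x, y) = (y', x') ->
    lact x (lact y m) = lact y' (lact x' m);
  lract : forall x m y, ract (lact x m) y = lact x (ract m y)
}.

Record bimoduleAlgebra (X : braidedSet) := BimoduleAlgebra {
  bimodalg_bimod :> bimodule X;
  bmul : bimodalg_bimod -> bimodalg_bimod -> bimodalg_bimod;
  bmulDl : forall n, {morph bmul^~ n : m m' / m + m'};
  bmulDr : forall m, {morph bmul m : n n' / n + n'};
  bmulA : associative bmul;
  bmul_lact : forall x m n, bmul (lact x m) n = lact x (bmul m n);
  bmul_ract : forall x m n, bmul m (ract n x) = ract (bmul m n) x;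
  bmul_rlact : forall x m n, bmul (ract m x) n = bmul m (lact x n)
}.

Definition trivial_bimodule (X : braidedSet) (K : comPzRingType) : bimodule X :=
  @Bimodule X K (fun m _ => m) (fun _ m => m)
    (fun _ _ _ => erefl) (fun _ _ _ => erefl)
    (fun _ _ _ _ _ _ => erefl) (fun _ _ _ _ _ _ => erefl)
    (fun _ _ _ => erefl).

Definition trivial_algebra (X : braidedSet) (K : comPzRingType) :
    bimoduleAlgebra X :=
  @BimoduleAlgebra X (trivial_bimodule X K) (fun a b : K => a * b)
    (fun n m m' => mulrDl m m' n) (@mulrDr K) (@mulrA K)
    (fun _ _ _ => erefl) (fun _ _ _ => erefl) (fun _ _ _ => erefl).

Section Cochains.
Variables (X : braidedSet) (M : bimodule X).

Definition cochain (k : nat) : zmodType := (k.-tuple X -> M)%type.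

(* [dl i] and [dr i] are d_l^{k+1;i+1} and d_r^{k+1;i+1}. The braids are      *)
(* applied to whole words of length k+1, hence shifted by i for [dr]: on the  *)
(* suffix starting at position i, the j-th generator acts as the (i+j)-th.    *)
Definition dl k (i : 'I_k.+1) (f : cochain k) : cochain k.+1 := fun w =>
  let w' := bexpr (iota 0 i) w in
  lact (tnth w' ord0) (f [tuple tnth w' (lift ord0 j) | j < k]).

Definition dr k (i : 'I_k.+1) (f : cochain k) : cochain k.+1 := fun w =>
  let w' := bexpr (rev (iota i (k - i))) w in
  ract (f [tuple tnth w' (lift ord_max j) | j < k]) (tnth w' ord_max).

(* the differential d^{k+1} : C^k -> C^{k+1} *)
Definition diff k (f : cochain k) : cochain k.+1 :=
  \sum_(i < k.+1) (dl i f - dr i f) *~ (-1) ^+ i.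

Lemma diffB k : {morph @diff k : f g / f - g}.
Proof.
move=> f g; rewrite /diff -sumrB; apply: eq_bigr => i _; rewrite -mulrzBl.
congr (_ *~ _).
have lactB x : {morph lact (b := M) x : m n / m - n}.
  move=> m n; apply: (addIr (lact x n)); rewrite -lactD subrK.
  by rewrite subrK.
have ractB x : {morph (ract (b := M))^~ x : m n / m - n}.
  move=> m n; apply: (addIr (ract n x)); rewrite -ractD subrK.
  by rewrite subrK.
have -> : dl i (f - g) = dl i f - dl i g.
  by apply/funext => w; apply: lactB.
have -> : dr i (f - g) = dr i f - dr i g.
  by apply/funext => w; apply: ractB.
by rewrite !opprB addrACA [RHS]addrACA [- dr i f - _]addrC.
Qed.

Lemma diff0 k : diff (0 : cochain k) = 0.
Proof. by rewrite -{1}(subrr 0) diffB subrr. Qed.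

Definition cocycle k : {pred cochain k} := fun f => diff f == 0.
Arguments cocycle : clear implicits.

Lemma cocycle_zmod_closed k : zmod_closed (cocycle k).
Proof.
split=> [|f g]; rewrite !unfold_in ?diff0 // => /eqP f0 /eqP g0.
by rewrite diffB f0 g0 subrr.
Qed.
HB.instance Definition _ k :=
  GRing.isZmodClosed.Build (cochain k) (cocycle k) (@cocycle_zmod_closed k).

Record cocycles k := Cocycle {
  cocycle_val :> cochain k;
  _ : cocycle_val \in cocycle k
}.
HB.instance Definition _ k := [isSub for @cocycle_val k].
HB.instance Definition _ k := [Choice of cocycles k by <:].
HB.instance Definition _ k :=
  [SubChoice_isSubZmodule of cocycles k by <:].

(* C^{-1} = 0, so that the only coboundary of degree 0 is 0 *)
Definition is_coboundary k : cochain k -> Prop :=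
  match k with
  | 0 => fun f => f = 0
  | k'.+1 => fun f => exists g : cochain k', f = diff g
  end.

Definition coboundary k : {pred cocycles k} :=
  fun z => `[< is_coboundary (cocycle_val z) >].
Arguments coboundary : clear implicits.

Lemma coboundary_zmod_closed k : zmod_closed (coboundary k).
Proof.
split=> [|f g].
  by apply/asboolP; case: k => [//|k] /=; exists 0; rewrite diff0.
move=> /asboolP Bf /asboolP Bg; apply/asboolP.
have -> : cocycle_val (f - g) = cocycle_val f - cocycle_val g by [].
case: k f g Bf Bg => [|k] /= f g; first by move=> -> ->; rewrite subrr.
by move=> [f' ->] [g' ->]; exists (f' - g'); rewrite diffB.
Qed.
HB.instance Definition _ k :=
  GRing.isZmodClosed.Build (cocycles k) (coboundary k)
    (@coboundary_zmod_closed k).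

(* Coboundaries are cut out among cocycles, so that the quotient makes sense *)
(* before d o d = 0 is known; this is then Ker d / Im d.                      *)
Definition cohomology k : zmodType := Quotient.quot (coboundary k).

Definition coho_class k (z : cocycles k) : cohomology k :=
  (\pi_(cohomology k) z)%qT.

End Cochains.

Definition smile (X : braidedSet) (M : bimoduleAlgebra X) p q
    (f : cochain M p) (g : cochain M q) : cochain M (p + q) := fun w =>
  \sum_(s in shuffles p q)
    (let w' := permT s^-1%g w in
     bmul (f [tuple tnth w' (lshift q i) | i < p])
          (g [tuple tnth w' (rshift p j) | j < q])) *~ (-1) ^+ perm_length s.

(* Graded algebras: a graded abelian group A is given by its homogeneous      *)
(* components, and a bilinear product on their direct sum, compatible with    *)
(* the grading, by its restrictions A_p x A_q -> A_{p+q}. No unit is required.*)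

Definition gcast (A : nat -> zmodType) m n (e : m = n) (a : A m) : A n :=
  ecast i (A i) e a.

Record graded_algebra (A : nat -> zmodType)
    (mul : forall p q, A p -> A q -> A (p + q)%N) : Prop := GradedAlgebra {
  gmulDl : forall p q (b : A q), {morph (mul p q)^~ b : a a' / a + a'};
  gmulDr : forall p q (a : A p), {morph mul p q a : b b' / b + b'};
  gmulA : forall p q r (a : A p) (b : A q) (c : A r),
    gcast (addnA p q r) (mul p (q + r)%N a (mul q r b c)) =
    mul (p + q)%N r (mul p q a b) c
}.

Record dg_algebra (A : nat -> zmodType) (d : forall k, A k -> A k.+1)
    (mul : forall p q, A p -> A q -> A (p + q)%N) : Prop := DGAlgebra {
  dga_algebra : graded_algebra mul;
  dgaD : forall k, {morph d k : a b / a + b};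
  dga_dd : forall k (a : A k), d k.+1 (d k a) = 0;
  dga_leibniz : forall p q (a : A p) (b : A q),
    d (p + q)%N (mul p q a b) =
      mul p.+1 q (d p a) b
      + gcast (addnS p q) (mul p q.+1 a (d q b)) *~ (-1) ^+ p
}.

Definition induced_product (X : braidedSet) (M : bimoduleAlgebra X)
    (mulH : forall p q,
      cohomology M p -> cohomology M q -> cohomology M (p + q)) : Prop :=
  forall p q (f : cocycles M p) (g : cocycles M q),
    exists2 h : cocycles M (p + q), (h : cochain M (p + q)) = smile f g &
      mulH p q (coho_class f) (coho_class g) = coho_class h.

(* Main.v *)
From HB Require Import structures.
From mathcomp Require Import all_boot all_order all_fingroup all_algebra.
From mathcomp Require Import boolp functions zify ring.
Require Import Defs.
Set Implicit Arguments.
Unset Strict Implicit.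
Unset Printing Implicit Defensive.
Import GRing.Theory.
Local Open Scope ring_scope.

(* A shuffle s in Sh_{p,q} is encoded by the binary word telling which of the *)
(* two blocks each letter of w goes to. A shortest expression of s^-1 sorts   *)
(* this word by exchanging adjacent letters in the wrong order, and sorting   *)
(* is confluent already by far commutativity; hence f \smile g is a signed    *)
(* sum over the unshuffles of w, computed by recursion on w. The Yang-Baxter  *)
(* equation makes this coproduct on words coassociative. The differential is  *)
(* the graded commutator with the tautological 1-cochain x |-> x acting on M, *)
(* so associativity yields the Leibniz rule, and also d d = 0.                *)
(*   For trivial coefficients, the sets X^k form a precubical set, with faces *)
(* moving a letter out of a word to the left or to the right, d is its        *)
(* cubical differential and \smile is Serre's product. The diagonal of a cube *)
(* is homotopic to its transpose; this homotopy is a tensor power of the one  *)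
(* for the interval and provides a cup-1 product, whose differential is the   *)
(* defect of commutativity of cocycles.                                       *)

(** All shuffle sums become [shsum], which deals the letters of a word into two blocks; a letter
    bound for the second block is braided across the first one. [ext_smile] identifies [smile] with
    the product [cup] defined this way. The point is [foldr_bact_unsh]: in a shortest expression of
    the inverse of a shuffle every generator removes one inversion of a binary word, and this forces
    its effect on words of letters.

    The Yang-Baxter equation, in the form [push_push], gives the coassociativity [shsum_coassoc],
    hence the associativity of [cup]. Let $t$ be the tautological 1-cochain. Then $dF = tF -
    (-1)^{|F|} F t$ ([diffw], [ext_diff]), $t t = 0$ by the compatibility of the actions with the
    braiding, and the two actions commute. So $d d = 0$ and the Leibniz rule ([diffw_diffw],
    [diffw_cup]) are formal computations with a graded commutator, made term by term on unshuffles
    into three blocks. The Leibniz rule makes the product well defined on classes ([mulHE]).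

    For trivial coefficients, words are cubes by [face_face], and by [shsum_faces] the two blocks of
    an unshuffle are complementary faces of the word. The diagonal $D$ of the cube and its transpose
    $D'$ satisfy $D' - D = h \partial + \partial h$ ([cup1L_homotopy]). On cocycles $\partial h$
    contributes nothing, so [diffw_cup1] presents the defect of commutativity as a coboundary. *)

Section SignedElements.
Variable V : zmodType.
Implicit Types x y : V.

Definition sgn n x : V := x *~ (-1) ^+ n.

Lemma sgnE n x : sgn n x = if odd n then - x else x.
Proof. by rewrite /sgn -signr_odd; case: odd; rewrite ?mulrN1z ?mulr1z. Qed.

Lemma sgnS n x : sgn n.+1 x = - sgn n x.
Proof. by rewrite !sgnE /=; case: odd; rewrite //= opprK. Qed.

Lemma sgn_sgn m n x : sgn m (sgn n x) = sgn (m + n) x.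
Proof. by rewrite !sgnE oddD; do 2!case: odd; rewrite //= opprK. Qed.

Lemma sgnK n : involutive (sgn n).
Proof. by move=> x; rewrite !sgnE; case: odd; rewrite ?opprK. Qed.

Lemma sgnD n x y : sgn n (x + y) = sgn n x + sgn n y.
Proof. by rewrite !sgnE; case: odd; rewrite // opprD. Qed.

Lemma sgnN n x : sgn n (- x) = - sgn n x.
Proof. by rewrite !sgnE; case: odd. Qed.

Lemma sgn0 n : sgn n 0 = 0.
Proof. by rewrite sgnE oppr0 if_same. Qed.

End SignedElements.

(** * Unshuffle sums and their coassociativity *)

Section Letters.
Variable X : braidedSet.
Implicit Types (x y z : X) (w a b c : seq X).
Local Notation sigma := (@braiding X).

Lemma yang_baxterE x y z :
  let: (y1, x1) := sigma (x, y) in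
  let: (z1, x2) := sigma (x1, z) in
  let: (z2, y2) := sigma (y1, z1) in
  let: (z3, y3) := sigma (y, z) in
  let: (z4, x3) := sigma (x, z3) in
  let: (y4, x4) := sigma (x3, y3) in
  [/\ z2 = z4, y2 = y4 & x2 = x4].
Proof.
have := yang_baxter (x, y, z); rewrite /braid12 /braid23.
case: (sigma (x, y)) => y1 x1; case: (sigma (x1, z)) => z1 x2.
case: (sigma (y1, z1)) => z2 y2; case: (sigma (y, z)) => z3 y3.
case: (sigma (x, z3)) => z4 x3; case: (sigma (x3, y3)) => y4 x4.
by case=> -> -> ->.
Qed.

(** The action of $b_k \cdots b_1$ on the word $x a$, $k$ being the length of $a$, with the outgoing
    letter kept apart. *)
Fixpoint push x a : seq X * X :=
  if a is y :: t then
    let: (y', x') := sigma (x, y) in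
    let: (t', x'') := push x' t in (y' :: t', x'')
  else ([::], x).

Lemma size_push x a : size (push x a).1 = size a.
Proof.
elim: a x => //= y t IHt x; case: (sigma _) => y' x'.
by case: (push x' t) (IHt x') => t' x'' /= ->.
Qed.

Lemma push_cat x a b :
  push x (a ++ b) =
  let: (a', x') := push x a in let: (b', x'') := push x' b in (a' ++ b', x'').
Proof.
elim: a x => [|y t IHt] x /=; first by case: (push x b).
case: (sigma _) => y' x'; rewrite IHt; case: (push x' t) => t' x''.
by case: (push x'' b).
Qed.

(** The Yang-Baxter equation for words: $x$ and $y$ may cross each other before or after passing
    through $a$, by one use of [yang_baxterE] per letter of $a$. *)
Lemma push_push x y a :
  let: (y', x') := sigma (x, y) in
  let: (a1, x1) := push x' a in
  let: (a2, y2) := push y' a1 in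
  let: (b1, y1) := push y a in
  let: (b2, x2) := push x b1 in
  a2 = b2 /\ sigma (x2, y1) = (y2, x1).
Proof.
elim: a x y => [|z t IHt] x y /=; first by case: (sigma (x, y)).
have := yang_baxterE x y z.
case: (sigma (x, y)) => y' x'; case E1: (sigma (x', z)) => [z1 x1].
case E2: (sigma (y', z1)) => [z2 y2]; case E3: (sigma (y, z)) => [z3 y3].
case E4: (sigma (x, z3)) => [z4 x3]; case E5: (sigma (x3, y3)) => [y4 x4].
case=> ? ? ?; subst.
have := IHt x3 y3; rewrite E5.
case: (push x4 t) => a1 x5; rewrite /= E2; case: (push y4 a1) => a2 y5.
case: (push y3 t) => b1 y6; rewrite /= E4; case: (push x3 b1) => b2 x6.
by case=> -> ->.
Qed.

End Letters.

Section ShuffleSums.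
Variable X : braidedSet.
Implicit Types (x y z : X) (w a b c : seq X).

(* The sum of [(-1)^|s| Phi a b] over the shuffles [s], where [T_{s^-1} w] is *)
(* cut into [a] and [b]; [x] goes either first in [a], or across [a] to [b].  *)
Fixpoint shsum (V : zmodType) w (Phi : seq X -> seq X -> V) : V :=
  if w is x :: w' then
    shsum w' (fun a b => Phi (x :: a) b
      + sgn (size a) (Phi (push x a).1 ((push x a).2 :: b)))
  else Phi [::] [::].

Section Linearity.
Variable V : zmodType.
Implicit Types Phi Psi : seq X -> seq X -> V.

Lemma eq_in_shsum w Phi Psi :
    (forall a b, (size a + size b)%N = size w -> Phi a b = Psi a b) ->
  shsum w Phi = shsum w Psi.
Proof.
elim: w Phi Psi => [|x w IHw] Phi Psi eqP /=; first exact: eqP.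
apply: IHw => a b ab; rewrite eqP ?eqP //=.
  by rewrite size_push addnS ab.
by rewrite addSn ab.
Qed.

Lemma eq_shsum w Phi Psi :
  (forall a b, Phi a b = Psi a b) -> shsum w Phi = shsum w Psi.
Proof. by move=> eqP; apply: eq_in_shsum. Qed.

Lemma shsumD w Phi Psi :
  shsum w (fun a b => Phi a b + Psi a b) = shsum w Phi + shsum w Psi.
Proof.
elim: w Phi Psi => //= x w IHw Phi Psi; rewrite -IHw; apply: eq_shsum => a b.
by rewrite sgnD addrACA.
Qed.

End Linearity.

Lemma shsum_additive (U V : zmodType) (h : U -> V) w Phi :
    {morph h : u v / u + v} -> h (shsum w Phi) = shsum w (fun a b => h (Phi a b)).
Proof.
move=> hD; have h0 : h 0 = 0 by apply: (addIr (h 0)); rewrite -hD !add0r.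
have hN u : h (- u) = - h u by apply: (addIr (h u)); rewrite -hD !addNr.
elim: w Phi => //= x w IHw Phi; rewrite IHw; apply: eq_shsum => a b.
by rewrite hD; congr (_ + _); rewrite !sgnE; case: odd.
Qed.

Lemma shsumN (V : zmodType) w (Phi : seq X -> seq X -> V) :
  shsum w (fun a b => - Phi a b) = - shsum w Phi.
Proof. by rewrite (shsum_additive (h := -%R)) // => ? ?; rewrite opprD. Qed.

Lemma shsum_sgn (V : zmodType) n w (Phi : seq X -> seq X -> V) :
  shsum w (fun a b => sgn n (Phi a b)) = sgn n (shsum w Phi).
Proof. by rewrite -shsum_additive // => ? ?; rewrite sgnD. Qed.

Lemma shsum0 (V : zmodType) w (Phi : seq X -> seq X -> V) :
    (forall a b, (size a + size b)%N = size w -> Phi a b = 0) ->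
  shsum w Phi = 0.
Proof.
move=> Phi0; rewrite (@eq_in_shsum _ _ _ (fun _ _ => 0)) //.
by apply: (addIr (shsum w (fun _ _ => 0 : V))); rewrite -shsumD !add0r.
Qed.

(** Crossing a word and then unshuffling it amounts to crossing both blocks of an unshuffle. A
    letter sent to the second block meets $x$ before or after crossing the first block, and
    [push_push] reconciles the two orders. *)
Lemma shsum_push (V : zmodType) x w (Psi : seq X -> seq X -> X -> V) :
  shsum (push x w).1 (fun a b => Psi a b (push x w).2) =
  shsum w (fun a b => let: (a', y) := push x a in
                      let: (b', z) := push y b in Psi a' b' z).
Proof.
elim: w x Psi => //= y w IHw x Psi.
case Exy: (braiding _) => [y' x'].
have IH := IHw x' (fun a b z => Psi (y' :: a) b z
  + sgn (size a) (Psi (push y' a).1 ((push y' a).2 :: b) z)).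
case E: (push x' w) IH => [w' x''] /= ->; apply: eq_shsum => a b /=.
have := push_push x y a; rewrite Exy.
have sz := size_push x' a.
case E1: (push x' a) sz => [a1 x1] /= sza1; case E2: (push y' a1) => [a2 y2].
case E3: (push y a) => [b1 y1] /=; case E4: (push x b1) => [b2 x2] [<- ->].
by case E5: (push x1 b) => [b3 z] /=; rewrite sza1.
Qed.

(** Both sides deal the letters into three blocks, and induction reduces the claim to the fate of
    the first letter: [Psi1] collects its arrivals in the first two blocks, [Psi2] that in the
    third. In the latter case the left side makes it cross a block not yet divided, hence
    [shsum_push]. *)
Lemma shsum_coassoc (V : zmodType) w (Phi : seq X -> seq X -> seq X -> V) :
  shsum w (fun a c => shsum a (fun a1 a2 => Phi a1 a2 c)) =
  shsum w (fun a b => shsum b (fun b1 b2 => Phi a b1 b2)).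
Proof.
elim: w Phi => //= x w IHw Phi.
pose Psi1 a1 a2 c := Phi (x :: a1) a2 c
  + sgn (size a1) (Phi (push x a1).1 ((push x a1).2 :: a2) c).
pose Psi2 a1 a2 c := let: (a1', y) := push x a1 in
  let: (a2', z) := push y a2 in
  sgn (size a1 + size a2) (Phi a1' a2' (z :: c)).
transitivity (shsum w (fun a c => shsum a (fun a1 a2 =>
    Psi1 a1 a2 c + Psi2 a1 a2 c))).
  apply: eq_shsum => a c; rewrite [RHS]shsumD; congr (_ + _).
  rewrite -shsum_sgn.
  rewrite (shsum_push x a (fun a1 a2 z => sgn (size a) (Phi a1 a2 (z :: c)))).
  apply: eq_in_shsum => a1 a2 sza; rewrite /Psi2 sza.
  by case: (push x a1) => ? y; case: (push y a2).
rewrite IHw; apply: eq_shsum => a b.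
rewrite -shsum_sgn -shsumD; apply: eq_shsum => b1 b2.
rewrite /Psi1 /Psi2; case: (push x a) => a' y /=.
case: (push y b1) => b1' z /=.
by rewrite sgnD sgn_sgn addrA.
Qed.

End ShuffleSums.

(** * Shuffles as sorted binary words *)

Section BitWords.
Implicit Types (u v : seq bool) (i j : nat).

Fixpoint swap i u : seq bool :=
  match i, u with
  | 0, [:: b, c & t] => [:: c, b & t]
  | i'.+1, b :: t => b :: swap i' t
  | _, _ => u
  end.

(** The two default values exclude descents at or beyond the last letter. *)
Definition descent i u := nth false u i && ~~ nth true u i.+1.

Fixpoint inversions u : nat :=
  if u is b :: t then ((if b then count negb t else 0) + inversions t)%N else 0.

Lemma count_negb u : count negb u = (size u - count id u)%N.
Proof.
rewrite -(count_predC id) addKn; exact: eq_count.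
Qed.

Lemma swapK i : involutive (swap i).
Proof. by elim: i => [|i IHi] [|b [|c t]] //=; rewrite IHi. Qed.

Lemma size_swap i u : size (swap i u) = size u.
Proof. by elim: i u => [|i IHi] [|b [|c t]] //=; rewrite IHi. Qed.

Lemma count_swap P i u : count P (swap i u) = count P u.
Proof.
elim: i u => [|i IHi] [|b t] //=; last by rewrite IHi.
by case: t => [|c t] //=; rewrite addnCA.
Qed.

Lemma nth_swap d i u j : (i.+1 < size u)%N ->
  nth d (swap i u) j =
  nth d u (if j == i then i.+1 else if j == i.+1 then i else j).
Proof.
elim: i u j => [|i IHi] [|b t] //; first by case: t => [|c t] // [|[|j]].
case=> [|j] //=; rewrite ltnS => /IHi ->; rewrite !eqSS.
by case: (j == i); case: (j == i.+1).
Qed.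

Lemma inv_swap i u : (inversions u <= (inversions (swap i u)).+1)%N.
Proof.
elim: i u => [|i IHi] [|b t] //=; first by case: b; case: t => [|[] t] //=; lia.
by rewrite count_swap; have := IHi t; lia.
Qed.

Lemma inv_swap_descent i u : descent i u -> inversions u = (inversions (swap i u)).+1.
Proof.
rewrite /descent; elim: i u => [|i IHi] [|b t] //=; last first.
  by rewrite count_swap => /IHi->; rewrite addnS.
by case: b; case: t => [|[] t] //= _; lia.
Qed.

Lemma descent_inv_swap i u : inversions u = (inversions (swap i u)).+1 -> descent i u.
Proof.
rewrite /descent; elim: i u => [|i IHi] [|b t] //=.
  by case: b; case: t => [|[] t] //=; lia.
by rewrite count_swap => invE; apply: IHi; lia.
Qed.

Lemma inv0_nseq u : inversions u = 0%N ->
  u = nseq (count negb u) false ++ nseq (count id u) true.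
Proof.
elim: u => [|[] u IHu] //= inv0; last by rewrite {1}IHu.
have [u0 v0] : count negb u = 0%N /\ inversions u = 0%N by lia.
by rewrite {1}IHu // u0.
Qed.

Lemma inv_gt0_descent u : (0 < inversions u)%N -> exists i, descent i u.
Proof.
elim: u => [|b u IHu] //=; have [u0|/IHu[i iu] _] := posnP (inversions u); last first.
  by exists i.+1.
rewrite u0 addn0; case: b => // cu; exists 0%N; rewrite /descent /=.
by rewrite (inv0_nseq u0); case: (count negb u) cu.
Qed.

Fixpoint allbits n : seq (seq bool) :=
  if n is n'.+1 then
    map (cons false) (allbits n') ++ map (cons true) (allbits n')
  else [:: [::]].

Lemma mem_allbits n u : (u \in allbits n) = (size u == n).
Proof.
elim: n u => [|n IHn] u /=; first by rewrite inE size_eq0.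
have consI b : injective (cons b : seq bool -> _) by move=> ? ? [].
rewrite mem_cat; case: u => [|[] u] /=.
- by apply/negbTE; rewrite negb_or; apply/andP; split; apply/negP => /mapP[].
- rewrite mem_map // IHn eqSS; case: (size u == n); rewrite ?orbT ?orbF //.
  by apply/negbTE/negP => /mapP[].
rewrite mem_map // IHn eqSS; case: (size u == n) => //=.
by apply/negbTE/negP => /mapP[].
Qed.

Lemma allbits_uniq n : uniq (allbits n).
Proof.
elim: n => //= n IHn.
have consI b : injective (cons b : seq bool -> _) by move=> ? ? [].
rewrite cat_uniq !map_inj_uniq // IHn /= andbT.
by apply/hasPn => _ /mapP[u _ ->]; apply/negP => /mapP[].
Qed.

End BitWords.

Section Unshuffle.
Variable X : braidedSet.
Implicit Types (u : seq bool) (w : seq X).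

(** The label [true] stands for the second block. *)
Fixpoint unsh u w : seq X * seq X :=
  match u, w with
  | b :: u', x :: w' =>
    let: (a, c) := unsh u' w' in
    if b then let: (a', x') := push x a in (a', x' :: c) else (x :: a, c)
  | _, _ => ([::], [::])
  end.

Lemma size_unsh u w : size u = size w ->
  size (unsh u w).1 = count negb u /\ size (unsh u w).2 = count id u.
Proof.
elim: u w => [|b u IHu] [|x w] //= [/IHu]; case: (unsh u w) => a c /= [<- <-].
by case: b => //=; case: (push x a) (size_push x a) => a' x' /= ->.
Qed.

Lemma unsh_inv0 u w : size u = size w -> inversions u = 0%N ->
  (unsh u w).1 ++ (unsh u w).2 = w.
Proof.
elim: u w => [|b u IHu] [|x w] //= [uw] inv0.
have [ue be] : inversions u = 0%N /\ (b -> count negb u = 0%N).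
  by case: b inv0 => /=; lia.
have := IHu w uw ue; have [su _] := size_unsh uw.
case: (unsh u w) su => a c /= su <-; case: b be {inv0} => //= /(_ isT) u0.
by move: su; rewrite u0; case: a.
Qed.

(** At a descent the left letter must cross its neighbour first, so [push] starts with this very
    braiding. Sorting steps may thus be made in any order, without the Yang-Baxter equation. *)
Lemma unsh_descent i u w : size u = size w -> descent i u ->
  unsh u w = unsh (swap i u) (bact_seq i w).
Proof.
rewrite /descent; elim: i u w => [|i IHi] [|b u] [|x w] //= [uw]; last first.
  by move=> /(IHi _ _ uw) ->.
case: u uw => [|c u]; first by rewrite andbF.
case: w => [|y w] //= [uw]; case: b; case: c => //= _.
case E: (unsh u w) => [a d] /=; case: (braiding _) => y' x' /=.
by rewrite E; case: (push x' a).
Qed.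

Lemma shsum_unsh (V : zmodType) w (Phi : seq X -> seq X -> V) :
  shsum w Phi = \sum_(u <- allbits (size w))
    sgn (inversions u) (Phi (unsh u w).1 (unsh u w).2).
Proof.
elim: w Phi => [|x w IHw] Phi /=; first by rewrite big_seq1 sgnE.
rewrite big_cat !big_map IHw /= -big_split.
apply: eq_big_seq => u; rewrite mem_allbits => /eqP /size_unsh[su _].
case: (unsh u w) su => a c /= su; rewrite sgnD; congr (_ + _).
by rewrite sgn_sgn su addnC; case: (push x a).
Qed.

End Unshuffle.

(** * Shortest expressions of inverses of shuffles *)

Section ShuffleBits.
Variables p q : nat.
Local Notation n := (p + q)%N.
Implicit Types (s t : 'S_n) (e : seq 'I_n.-1).

Definition bits t : seq bool := [seq (p <= t v)%N | v <- enum 'I_n].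

(* says that [t^-1] is a shuffle *)
Definition unshuffle t : Prop := forall v v' : 'I_n,
  (v < v')%N -> (p <= t v)%N = (p <= t v')%N -> (t v < t v')%N.

Lemma size_bits t : size (bits t) = n.
Proof. by rewrite size_map size_enum_ord. Qed.

Lemma nth_bits d t (v : 'I_n) : nth d (bits t) v = (p <= t v)%N.
Proof. by rewrite (nth_map v) ?size_enum_ord // nth_ord_enum. Qed.

Lemma count_bits t : count id (bits t) = q.
Proof.
have -> : bits t =
    [seq (p <= v)%N | v <- [seq val i | i <- [seq t v | v <- enum 'I_n]]].
  by rewrite /bits -!map_comp.
have tE : perm_eq (iota 0 n) [seq val i | i <- [seq t v | v <- enum 'I_n]].
  rewrite -val_enum_ord; apply/perm_map/uniq_perm; rewrite ?enum_uniq //.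
    by rewrite map_inj_uniq ?enum_uniq //; apply: perm_inj.
  move=> i; rewrite mem_enum; apply/esym/mapP; exists (t^-1%g i).
    by rewrite mem_enum.
  by rewrite permKV.
rewrite count_map -(seq.permP tE).
rewrite iotaD count_cat (@eq_in_count _ _ pred0) ?count_pred0 => [|i]; last first.
  by rewrite mem_iota /=; lia.
rewrite (@eq_in_count _ _ predT) ?count_predT ?size_iota // => i.
by rewrite mem_iota /=; lia.
Qed.

Lemma count_negb_bits t : count negb (bits t) = p.
Proof.
by rewrite count_negb size_bits count_bits addnK.
Qed.

Lemma shuffles_unshuffle s : reflect (unshuffle s^-1%g) (s \in shuffles p q).
Proof.
rewrite inE; apply: (iffP andP) => [[/forallP sp /forallP sq] v v' vv'|sh].
  have neq : s^-1%g v != s^-1%g v' by rewrite (inj_eq perm_inj) neq_ltn vv'.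
  move=> eq_pv; rewrite ltnNge leq_eqVlt negb_or eq_sym neq /=; apply/negP => lt.
  suff: (v' < v)%N by rewrite ltnNge ltnW.
  rewrite -[v](permKV s) -[v'](permKV s).
  case: (split_ordP (s^-1%g v)) eq_pv lt => [i|i] ->;
    case: (split_ordP (s^-1%g v')) => [j|j] -> /=.
  - by move=> _ lt; have /forallP/(_ i)/implyP := sp j; apply.
  - by have := ltn_ord i; lia.
  - by have := ltn_ord j; lia.
  by move=> _ lt; have /forallP/(_ i)/implyP := sq j; apply; lia.
split; apply/forallP => i; apply/forallP => j; apply/implyP => ij.
  rewrite ltnNge leq_eqVlt negb_or; apply/andP; split.
    by rewrite eq_sym (inj_eq val_inj) (inj_eq perm_inj) neq_ltn /= ij.
  apply/negP => /sh; rewrite !permK /= => lt.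
  by have := ltn_ord i; have := ltn_ord j; lia.
rewrite ltnNge leq_eqVlt negb_or; apply/andP; split.
  by rewrite eq_sym (inj_eq val_inj) (inj_eq perm_inj) neq_ltn /= ltn_add2l ij.
apply/negP => /sh; rewrite !permK /= => lt.
by have := ltn_ord i; have := ltn_ord j; lia.
Qed.

(** An increasing self-map of a finite ordinal moves nothing down; this applies to [s] and to its
    inverse. *)
Lemma perm_mono_id m (s : 'S_m) :
  (forall i j : 'I_m, (i < j)%N -> (s i < s j)%N) -> s = 1%g.
Proof.
have le_mono (r : 'S_m) : (forall i j : 'I_m, (i < j)%N -> (r i < r j)%N) ->
    forall i : 'I_m, (i <= r i)%N.
  move=> mono [i im]; elim: i im => //= i IHi im.
  by apply: leq_ltn_trans (IHi (ltnW im)) (mono _ _ _) => /=.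
move=> mono; apply/permP => i; apply/val_inj/eqP; rewrite perm1 eqn_leq.
rewrite (le_mono s) // andbT -{2}[i](permK s); apply: le_mono => j k jk.
rewrite ltnNge leq_eqVlt negb_or; apply/andP; split.
  by rewrite eq_sym (inj_eq val_inj) (inj_eq perm_inj) neq_ltn /= jk.
by apply/negP => /mono; rewrite !permKV ltnNge ltnW.
Qed.

(** The permutation [t^-1 * t'] is increasing: between the blocks because the labels agree, inside a
    block because both [t] and [t'] preserve the order there. *)
Lemma bits_inj t t' : unshuffle t -> unshuffle t' -> bits t = bits t' -> t = t'.
Proof.
move=> sh sh' tt'; have pE v : (p <= t v)%N = (p <= t' v)%N.
  by rewrite -!(nth_bits false) tt'.
suff /(congr1 (mulg t)) : (t^-1 * t' = 1)%g by rewrite mulKVg mulg1.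
apply: perm_mono_id => i j; rewrite !permM -{1}[i](permKV t) -{1}[j](permKV t).
move: (t^-1%g i) (t^-1%g j) => v v' lt.
have [eq_p|neq_p] := eqVneq (p <= t v)%N (p <= t v')%N; last first.
  by move: (pE v) (pE v') neq_p; lia.
apply: sh'; last by rewrite -!pE.
rewrite ltnNge leq_eqVlt negb_or; apply/andP; split.
  by rewrite eq_sym (inj_eq val_inj) -(inj_eq (@perm_inj _ t)) neq_ltn lt.
by apply/negP => /sh; rewrite eq_p => /(_ erefl); rewrite ltnNge ltnW.
Qed.

Lemma val_adj (i : 'I_n.-1) (v : 'I_n) :
  val (adj i v) =
  if v == i :> nat then i.+1 else if v == i.+1 :> nat then i : nat else v.
Proof.
rewrite /adj; case: tpermP => [->|->|/eqP ne1 /eqP ne2] /=.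
- by rewrite eqxx.
- by rewrite eqn_leq ltnn eqxx.
by rewrite -!(inj_eq val_inj) /= in ne1 ne2; rewrite (negbTE ne1) (negbTE ne2).
Qed.

Lemma bits_adj (i : 'I_n.-1) t : bits (adj i * t) = swap i (bits t).
Proof.
have in_ : (i.+1 < n)%N by rewrite -ltn_predRL.
apply: (@eq_from_nth _ false) => [|v]; rewrite ?size_swap !size_bits // => vn.
rewrite nth_swap ?size_bits // (nth_bits false _ (Ordinal vn)) permM -(nth_bits false).
by rewrite val_adj.
Qed.

Lemma expr_perm_rcons e i : expr_perm (rcons e i) = (adj i * expr_perm e)%g.
Proof. by rewrite -cats1 expr_perm_cat /= mul1g. Qed.

Lemma expr_perm_rev e : expr_perm (rev e) = (expr_perm e)^-1%g.
Proof.
elim: e => [|i e IHe] /=; first by rewrite invg1.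
by rewrite rev_cons expr_perm_rcons IHe invMg tpermV.
Qed.

Lemma bits1 : bits 1 = nseq p false ++ nseq q true.
Proof.
apply: (@eq_from_nth _ false) => [|v]; rewrite size_bits ?size_cat ?size_nseq // => vn.
rewrite (nth_bits false _ (Ordinal vn)) perm1 nth_cat size_nseq !nth_nseq leqNgt.
by case: ltnP => //= pv; rewrite (_ : v - p < q)%N //; lia.
Qed.

Lemma inv_bits1 : inversions (bits 1) = 0%N.
Proof.
rewrite bits1; elim: p => [|k IHk] //=; elim: q => [|k IHk] //=.
by rewrite IHk addn0; elim: k {IHk}.
Qed.

(** Sorting by adjacent exchanges: the generator of a descent of [u] is put at the right end, which
    acts first. It reverses the order of one pair of positions only, and their labels differ, so
    each block stays in order. *)
Lemma unshuffle_expr u : size u = n -> count id u = q ->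
  exists e,
    [/\ size e = inversions u, unshuffle (expr_perm e) & bits (expr_perm e) = u].
Proof.
move: {-1}(inversions u) (erefl (inversions u)) => m; elim: m u => [|m IHm] u um un uq.
  have up : count negb u = p by rewrite count_negb un uq addnK.
  exists [::]; split=> //; first by move=> v v' vv' _; rewrite !perm1.
  by rewrite bits1 (inv0_nseq um) up uq.
have [i di] : exists i, descent i u by apply: inv_gt0_descent; rewrite um.
have in1 : (i.+1 < size u)%N.
  rewrite ltnNge; apply/negP => /(nth_default true) ui1.
  by move: di; rewrite /descent ui1 andbF.
have in_ : (i < n.-1)%N by rewrite ltn_predRL -un.
have := inv_swap_descent di; rewrite um => -[/esym um'].
have [||e [se she be]] := IHm _ um'; rewrite ?size_swap ?count_swap //.
have bE : bits (expr_perm (rcons e (Ordinal in_))) = u.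
  by rewrite expr_perm_rcons bits_adj be swapK.
exists (rcons e (Ordinal in_)); split; rewrite ?size_rcons ?se //.
move=> v v' vv' eq_p.
have eq_u : nth false u v = nth false u v' by rewrite -bE !nth_bits.
move: eq_p; rewrite expr_perm_rcons !permM => eq_p; apply: she => //.
rewrite !val_adj /=; case/andP: di => ui ui1.
have {}ui1 : nth false u i.+1 = false.
  by rewrite (set_nth_default true) //; apply/negbTE.
have [vi|vi] := eqVneq (v : nat) i; have [vi'|vi'] := eqVneq (v' : nat) i.+1.
- by move: eq_u; rewrite vi vi' ui ui1.
- by do ?[case: ifPn => ?]; lia.
- by do ?[case: ifPn => ?]; lia.
by do ?[case: ifPn => ?]; lia.
Qed.

Lemma inv_bits_expr e : (inversions (bits (expr_perm e)) <= size e)%N.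
Proof.
elim/last_ind: e => [|e i IHe]; first by rewrite inv_bits1.
rewrite expr_perm_rcons bits_adj size_rcons.
by apply: leq_trans (inv_swap i _) _; rewrite swapK ltnS.
Qed.

(** A generator changes the number of inversions by at most one, which bounds the length of any
    expression from below; sorting attains the bound. *)
Lemma unshuffle_size e : unshuffle (expr_perm e) ->
    shortest_expr (expr_perm e) e -> size e = inversions (bits (expr_perm e)).
Proof.
move=> she [_ min_e].
have [||e' [se' she' be']] := @unshuffle_expr (bits (expr_perm e)).
- exact: size_bits.
- exact: count_bits.
apply/eqP; rewrite eqn_leq inv_bits_expr andbT -se' min_e //.
exact: bits_inj.
Qed.

Lemma shortest_expr_rev s e : shortest_expr s e -> shortest_expr s^-1%g (rev e).
Proof.
case=> <- min_e; split=> [|e' e's]; first exact: expr_perm_rev.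
by rewrite size_rev -(size_rev e') min_e // expr_perm_rev e's invgK.
Qed.

Lemma perm_length_shuffle s : s \in shuffles p q ->
  perm_length s = inversions (bits s^-1).
Proof.
move/shuffles_unshuffle => shs; rewrite /perm_length /some_expr.
case: cid => e /= /shortest_expr_rev er.
by case: (er) => rE _; rewrite -size_rev unshuffle_size rE.
Qed.

(** The bound on the length forces each generator to remove an inversion, so that [unsh_descent]
    applies at every step. All shortest expressions therefore act alike, whichever one [some_expr]
    picks. *)
Lemma foldr_bact_unsh (X : braidedSet) e (w : seq X) : size w = n ->
    (size e <= inversions (bits (expr_perm e)))%N ->
  foldr (@bact_seq X) w (map val e) =
  (unsh (bits (expr_perm e)) w).1 ++ (unsh (bits (expr_perm e)) w).2.
Proof.
elim/last_ind: e w => [|e i IHe] w wn.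
  by rewrite unsh_inv0 ?size_bits ?inv_bits1.
rewrite map_rcons foldr_rcons expr_perm_rcons bits_adj size_rcons.
have := inv_swap i (swap i (bits (expr_perm e))); rewrite swapK => ub lb.
have lbe : (size e <= inversions (bits (expr_perm e)))%N by lia.
rewrite IHe ?size_bact_seq // (@unsh_descent _ i (swap _ _)) ?swapK //.
  by rewrite size_swap size_bits.
by apply: descent_inv_swap; rewrite swapK; have := inv_bits_expr e; lia.
Qed.

Lemma permT_shuffle (X : braidedSet) s (w : n.-tuple X) : s \in shuffles p q ->
  val (permT s^-1%g w) = (unsh (bits s^-1) w).1 ++ (unsh (bits s^-1) w).2.
Proof.
move/shuffles_unshuffle => shs; rewrite /permT /some_expr.
case: cid => e /= se; have eE := se.1; rewrite -eE in shs se.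
have -> l : val (bexpr l w) = foldr (@bact_seq X) w l.
  by elim: l => //= i l <-.
by rewrite foldr_bact_unsh ?size_tuple ?eE // -eE unshuffle_size.
Qed.

Lemma sum_shuffles (V : zmodType) (F : seq bool -> V) :
  \sum_(s in shuffles p q) F (bits s^-1) =
  \sum_(u <- allbits n | count id u == q) F u.
Proof.
rewrite -big_enum -(big_map (fun s => bits s^-1) xpredT F) -[RHS]big_filter.
apply/perm_big/uniq_perm.
- rewrite map_inj_in_uniq ?enum_uniq // => s s'; rewrite !mem_enum.
  move=> /shuffles_unshuffle sh /shuffles_unshuffle sh' /(bits_inj sh sh').
  exact: invg_inj.
- exact/filter_uniq/allbits_uniq.
move=> u; rewrite mem_filter mem_allbits; apply/mapP/andP => [[s _ ->]|].
  by rewrite size_bits count_bits !eqxx.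
case=> /eqP uq /eqP un; have [e [_ she be]] := unshuffle_expr un uq.
exists (expr_perm e)^-1%g; last by rewrite invgK.
by rewrite mem_enum; apply/shuffles_unshuffle; rewrite invgK.
Qed.

End ShuffleBits.

(** * The cup product *)

Section Extension.
Variables (X : braidedSet) (M : bimodule X).
Implicit Types (k : nat) (w : seq X).

(* Extending cochains by 0 to words of any length dispenses with casts. *)
Definition ext k (f : cochain M k) w : M := oapp f 0 (insub w).

Lemma extE k (f : cochain M k) (t : k.-tuple X) : ext f t = f t.
Proof. by rewrite /ext valK. Qed.

Lemma ext_out k (f : cochain M k) w : size w <> k -> ext f w = 0.
Proof. by move=> wk; rewrite /ext insubN //; apply/eqP. Qed.

Lemma ext_inj k (f g : cochain M k) : ext f =1 ext g -> f = g.
Proof. by move=> fg; apply/funext => t; rewrite -!extE fg. Qed.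

Lemma extD k (f g : cochain M k) w : ext (f + g) w = ext f w + ext g w.
Proof. by rewrite /ext; case: insubP => [t _ _|_] //=; rewrite addr0. Qed.

Lemma extN k (f : cochain M k) w : ext (- f) w = - ext f w.
Proof. by rewrite /ext; case: insubP => [t _ _|_] //=; rewrite oppr0. Qed.

Lemma ext0 k w : ext (0 : cochain M k) w = 0.
Proof. by rewrite /ext; case: insubP. Qed.

Lemma ext_sgn n k (f : cochain M k) w :
  ext (f *~ (-1) ^+ n) w = sgn n (ext f w).
Proof. by rewrite -/(sgn n f) !sgnE; case: odd; rewrite ?extN. Qed.

Lemma ext_gcast k l (e : k = l) (f : cochain M k) :
  ext (gcast (A := cochain M) e f) = ext f.
Proof. by case: l / e. Qed.

Lemma lact0 x : lact x (0 : M) = 0.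
Proof. by apply: (addIr (lact x 0)); rewrite -lactD !add0r. Qed.

Lemma lactN x : {morph lact (b := M) x : m / - m}.
Proof. by move=> m; apply: (addIr (lact x m)); rewrite -lactD !addNr lact0. Qed.

Lemma ract0 x : ract (0 : M) x = 0.
Proof. by apply: (addIr (ract 0 x)); rewrite -ractD !add0r. Qed.

Lemma ractN x : {morph (ract (b := M))^~ x : m / - m}.
Proof. by move=> m; apply: (addIr (ract m x)); rewrite -ractD !addNr ract0. Qed.

End Extension.

Lemma tval_tnth_addn (T : Type) n m c (w : n.-tuple T) (F : 'I_m -> 'I_n) :
    (forall i, F i = c + i :> nat)%N ->
  [tuple tnth w (F i) | i < m] = take m (drop c w) :> seq T.
Proof.
case: m F => [|m] F FE; first by rewrite take0; apply/size0nil; rewrite size_tuple.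
pose x0 := tnth w (F ord0).
have cm : (c + m < n)%N by rewrite -(FE ord_max).
apply: (@eq_from_nth _ x0) => [|i].
  by rewrite size_tuple size_takel // size_drop size_tuple; lia.
rewrite size_tuple => im; rewrite -(tnth_nth x0 _ (Ordinal im)) tnth_mktuple.
by rewrite (tnth_nth x0) FE nth_take // nth_drop.
Qed.

Section CupProduct.
Variables (X : braidedSet) (M : bimoduleAlgebra X).
Implicit Types (F G : seq X -> M) (w a b c : seq X).

Lemma bmul0l m : bmul (0 : M) m = 0.
Proof. by apply: (addIr (bmul 0 m)); rewrite -bmulDl !add0r. Qed.

Lemma bmul0r m : bmul m (0 : M) = 0.
Proof. by apply: (addIr (bmul m 0)); rewrite -bmulDr !add0r. Qed.

Lemma bmulNl (m n : M) : bmul (- m) n = - bmul m n.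
Proof. by apply: (addIr (bmul m n)); rewrite -bmulDl !addNr bmul0l. Qed.

Lemma bmulNr (m n : M) : bmul m (- n) = - bmul m n.
Proof. by apply: (addIr (bmul m n)); rewrite -bmulDr !addNr bmul0r. Qed.

Definition cup F G w := shsum w (fun a b => bmul (F a) (G b)).

(** Extension by zero selects, among all unshuffles of [w], those with blocks of lengths [p] and
    [q]; these correspond to the shuffles. *)
Lemma ext_smile p q (f : cochain M p) (g : cochain M q) :
  ext (smile f g) =1 cup (ext f) (ext g).
Proof.
move=> w; have [wn|wn] := eqVneq (size w) (p + q)%N; last first.
  rewrite ext_out; last exact/eqP.
  rewrite /cup shsum0 // => a b ab; have [ap|/eqP ap] := eqVneq (size a) p.
    by rewrite (@ext_out _ _ _ g) ?bmul0r //; lia.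
  by rewrite (ext_out f) ?bmul0l.
have [t ->] : exists t : (p + q).-tuple X, w = t by exists (Tuple (introT eqP wn)).
rewrite extE /cup shsum_unsh size_tuple /smile.
pose H u := sgn (inversions u) (bmul (ext f (unsh u t).1) (ext g (unsh u t).2)).
transitivity (\sum_(s in shuffles p q) H (bits s^-1)); last first.
  rewrite sum_shuffles big_mkcond; apply: eq_big_seq => u.
  rewrite mem_allbits => /eqP un; case: ifP => [//|/eqP uq].
  have [|_ s2] := @size_unsh X u t; first by rewrite size_tuple.
  by rewrite (@ext_out _ _ _ g) ?s2 // bmul0r sgn0.
apply: eq_bigr => s sh; rewrite /H /sgn perm_length_shuffle //; congr (_ *~ _).
have [|s1 s2] := @size_unsh X (bits s^-1) t; first by rewrite size_bits size_tuple.
rewrite count_negb_bits count_bits in s1 s2.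
have wE := permT_shuffle t sh.
congr bmul; rewrite -extE; congr ext.
  by rewrite (@tval_tnth_addn _ _ _ 0) // drop0 wE take_size_cat.
rewrite (@tval_tnth_addn _ _ _ p) // wE drop_size_cat //.
by rewrite take_oversize ?s2.
Qed.

Lemma cupA F G H w : cup F (cup G H) w = cup (cup F G) H w.
Proof.
rewrite /cup; transitivity (shsum w (fun a c => shsum a (fun a1 a2 =>
    bmul (bmul (F a1) (G a2)) (H c)))); last first.
  apply: eq_shsum => a b; rewrite (shsum_additive (h := (@bmul _ _)^~ _)) //.
  by move=> m n; rewrite bmulDl.
rewrite (shsum_coassoc w (fun a1 a2 c => bmul (bmul (F a1) (G a2)) (H c))).
apply: eq_shsum => a b; rewrite (shsum_additive (h := @bmul _ _ _)).
  by apply: eq_shsum => b1 b2; rewrite bmulA.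
by move=> m n; rewrite bmulDr.
Qed.

Lemma eq_cup F F' G G' : F =1 F' -> G =1 G' -> cup F G =1 cup F' G'.
Proof. by move=> FF GG w; apply: eq_shsum => a b; rewrite FF GG. Qed.

Lemma cochain_graded_algebra : graded_algebra (A := cochain M) (@smile X M).
Proof.
split=> [p q g f f'|p q f g g'|p q r f g h]; apply: ext_inj => w.
- rewrite extD !ext_smile -shsumD; apply: eq_shsum => a b.
  by rewrite extD bmulDl.
- rewrite extD !ext_smile -shsumD; apply: eq_shsum => a b.
  by rewrite extD bmulDr.
rewrite ext_gcast !ext_smile.
transitivity (cup (ext f) (cup (ext g) (ext h)) w).
  by apply: eq_cup => //; apply: ext_smile.
rewrite cupA; apply: eq_cup => // a; exact/esym/ext_smile.
Qed.

End CupProduct.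

(** * The differential *)

Section Faces.
Variables (X : braidedSet) (V : zmodType).
Implicit Types (x y : X) (w a b : seq X).

(* The letter i of a word (from 0), moved to the left, resp. right, end. *)
Definition lmove i w : seq X := foldr (@bact_seq X) w (iota 0 i).
Definition rmove i w : seq X :=
  foldr (@bact_seq X) w (rev (iota i ((size w).-1 - i))).

Lemma foldr_bact_cons x w (e : seq nat) :
  foldr (@bact_seq X) (x :: w) (map S e) = x :: foldr (@bact_seq X) w e.
Proof. by elim: e => //= i e ->. Qed.

Lemma iotaS i n : iota i.+1 n = map S (iota i n).
Proof. exact: (iotaDl 1). Qed.

Lemma lmove_cons i x w : lmove i.+1 (x :: w) = bact_seq 0 (x :: lmove i w).
Proof. by rewrite /lmove -foldr_bact_cons -iotaS. Qed.

Lemma size_foldr_bact w (e : seq nat) : size (foldr (@bact_seq X) w e) = size w.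
Proof. by elim: e => //= i e; rewrite size_bact_seq. Qed.

Lemma size_lmove i w : size (lmove i w) = size w.
Proof. exact: size_foldr_bact. Qed.

Lemma size_rmove i w : size (rmove i w) = size w.
Proof. exact: size_foldr_bact. Qed.

Lemma rmove_cons i x w : (i < size w)%N -> rmove i.+1 (x :: w) = x :: rmove i w.
Proof.
move=> iw; rewrite /rmove -foldr_bact_cons map_rev -iotaS.
by case: w iw => //= y w _; rewrite subSS.
Qed.

Lemma rmove0 x w : rmove 0 (x :: w) = rcons (push x w).1 (push x w).2.
Proof.
rewrite /rmove /= subn0; elim: w x => //= y w IHw x.
rewrite rev_cons foldr_rcons /= iotaS -map_rev.
by case: (braiding _) => y' x'; rewrite foldr_bact_cons IHw; case: (push x' w).
Qed.

Definition lterm (Psi : X -> seq X -> V) w : V :=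
  if w is x :: a then Psi x a else 0.

Definition rterm (Psi : seq X -> X -> V) w : V :=
  if w is x :: a then Psi (belast x a) (last x a) else 0.

Lemma rterm_rcons Psi w x : rterm Psi (rcons w x) = Psi w x.
Proof. by case: w => //= y w; rewrite belast_rcons last_rcons. Qed.

Definition monol (Psi : X -> V) a : V := if a is [:: x] then Psi x else 0.

Lemma shsum_nill w (Psi : seq X -> V) :
  shsum w (fun a b => if a is [::] then Psi b else 0) = Psi w.
Proof.
elim: w Psi => //= x w IHw Psi; rewrite -(IHw (fun b => Psi (x :: b))).
apply: eq_shsum => -[|y a] b /=; rewrite add0r ?sgnE //.
by case: (braiding _) => ? ?; case: push => ? ? /=; rewrite oppr0 if_same.
Qed.

Lemma shsum_nilr w (Psi : seq X -> V) :
  shsum w (fun a b => if b is [::] then Psi a else 0) = Psi w.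
Proof.
elim: w Psi => //= x w IHw Psi; rewrite -(IHw (fun b => Psi (x :: b))).
by apply: eq_shsum => a b; rewrite sgn0 addr0.
Qed.

(** A letter that forms the first block alone is crossed by the letters before it, whence the
    sign. *)
Lemma shsum_monol w (Psi : X -> seq X -> V) :
  shsum w (fun a b => monol (Psi^~ b) a) =
  \sum_(i < size w) sgn i (lterm Psi (lmove i w)).
Proof.
elim: w Psi => [|x w IHw] Psi /=; first by rewrite big_ord0.
rewrite shsumD big_ord_recl sgnE /=; congr (_ + _).
  rewrite -(shsum_nill w (Psi x)); apply: eq_shsum => -[] //.
(* Here $x$ goes to the second block and crosses the single letter $y$ of the first one; the minus
   sign is that of this crossing. *)
pose Psi' y b := - Psi (braiding (x, y)).1 ((braiding (x, y)).2 :: b).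
transitivity (shsum w (fun a b => monol (Psi'^~ b) a)).
  apply: eq_shsum => -[|y [|z a]] b //=; rewrite /Psi'.
  - by case: (braiding _) => y' x'; rewrite sgnS sgnE.
  case: (braiding _) => y' x'; case: (braiding _) => z' x''.
  by case: push => ? ?; rewrite sgn0.
rewrite IHw; apply: eq_bigr => i _; rewrite sgnS -sgnN; congr sgn.
rewrite -[fintype.bump 0 i]/(i.+1) lmove_cons /=.
case E: (lmove i w) => [|y b] /=.
  by have := size_lmove i w; have := ltn_ord i; rewrite E /=; lia.
by rewrite /Psi'; case: (braiding _).
Qed.

Lemma shsum_monor w (Psi : seq X -> X -> V) :
  shsum w (fun a b => monol (Psi a) b) =
  \sum_(i < size w) sgn ((size w).-1 - i) (rterm Psi (rmove i w)).
Proof.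
elim: w Psi => [|x w IHw] Psi /=; first by rewrite big_ord0.
rewrite shsumD big_ord_recl addrC subn0; congr (_ + _).
  rewrite rmove0 rterm_rcons.
  rewrite -(shsum_nilr w (fun a => sgn (size w) (Psi (push x a).1 (push x a).2))).
  apply: eq_in_shsum => a [|y b] /= ab; last by rewrite sgn0.
  by rewrite -ab addn0.
rewrite (IHw (fun a => Psi (x :: a))); apply: eq_bigr => i _.
have iw := ltn_ord i; rewrite /= -[fintype.bump 0 i]/(i.+1) rmove_cons //.
congr sgn; first by lia.
by case E: (rmove i w) => [|y b] //=; have := size_rmove i w; rewrite E /=; lia.
Qed.

End Faces.

Section Differential.
Variables (X : braidedSet) (M : bimodule X).
Implicit Types (F : seq X -> M) (w a b c : seq X) (m : M).

Definition lact1 a m : M := monol (fun x => lact x m) a.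
Definition ract1 m b : M := monol (ract m) b.

(** The sign is $(-1)^{|F|}$ in the graded commutator $tF - (-1)^{|F|} F t$. *)
Definition diffw F w : M :=
  shsum w (fun a b => lact1 a (F b) - sgn (size a) (ract1 (F a) b)).

(** For $w$ of length $n$, moving the letter $i$ to the right end costs $n-1-i$ crossings; with the
    commutator sign $(-1)^{n-1}$ this leaves $(-1)^i$. *)
Lemma diffwE F w : diffw F w = \sum_(i < size w)
  sgn i (lterm (fun x b => lact x (F b)) (lmove i w)
         - rterm (fun a x => ract (F a) x) (rmove i w)).
Proof.
rewrite /diffw shsumD (shsum_monol w (fun x b => lact x (F b))).
rewrite (_ : shsum _ _ = - sgn (size w).-1 (shsum w (fun a b => ract1 (F a) b)));
  last first.
  rewrite -shsum_sgn -shsumN; apply: eq_in_shsum => a [|x [|y b]] /= ab;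
    rewrite ?sgn0 //.
  by rewrite -ab addn1.
rewrite (shsum_monor w (fun a x => ract (F a) x)).
rewrite -sgnN -sumrN (big_morph _ (@sgnD _ _) (sgn0 _ _)) -big_split /=.
apply: eq_bigr => i _; rewrite sgnD; congr (_ + _).
have iw := ltn_ord i; rewrite sgnN sgn_sgn sgnN !sgnE.
rewrite (_ : odd (_ + (_ - i)) = odd i) //.
by rewrite oddD oddB ?addbA ?addbb //; lia.
Qed.

Lemma tuple_behead k (w : k.+1.-tuple X) :
  tval w = tnth w ord0 :: [tuple tnth w (lift ord0 j) | j < k].
Proof.
rewrite (@tval_tnth_addn _ _ _ 1) //.
case: w => -[//|x w] wk; rewrite (tnth_nth x) /= drop0 take_oversize //.
by move: wk => /= /eqP[->].
Qed.

Lemma tuple_belast k (w : k.+1.-tuple X) :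
  tval w = rcons [tuple tnth w (lift ord_max j) | j < k] (tnth w ord_max).
Proof.
rewrite (@tval_tnth_addn _ _ _ 0) => [|i]; last by rewrite lift_max.
case: w => w wk; rewrite drop0 /=; case: w wk => [//|x w] wk.
rewrite (tnth_nth x) /= -take_nth ?take_oversize //.
  by rewrite (eqP wk).
by rewrite (eqP wk).
Qed.

Lemma val_bexpr k (e : seq nat) (w : k.-tuple X) :
  val (bexpr e w) = foldr (@bact_seq X) w e.
Proof. by elim: e => //= i e <-. Qed.

Lemma ext_diff k (f : cochain M k) : ext (diff f) =1 diffw (ext f).
Proof.
move=> w; have [wk|wk] := eqVneq (size w) k.+1; last first.
  rewrite ext_out; last exact/eqP.
  rewrite /diffw shsum0 // => a b ab.
  have -> : lact1 a (ext f b) = 0.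
    by case: a ab => [|x [|y a]] //= ab; rewrite /lact1 /= ext_out ?lact0 //; lia.
  have -> : ract1 (ext f a) b = 0.
    by case: b ab => [|x [|y b]] //= ab; rewrite /ract1 /= ext_out ?ract0 //; lia.
  by rewrite sgn0 subrr.
have [t ->] : exists t : k.+1.-tuple X, w = t by exists (Tuple (introT eqP wk)).
rewrite extE diffwE size_tuple /diff fct_sumE; apply: eq_bigr => i _.
transitivity (sgn i ((dl i f - dr i f) t)).
  by rewrite -/(sgn i (dl i f - dr i f)) !sgnE; case: odd.
congr sgn; congr (_ - _).
  have := tuple_behead (bexpr (iota 0 i) t); rewrite val_bexpr -/(lmove i t) => ->.
  by rewrite /dl /lterm -extE.
have := tuple_belast (bexpr (rev (iota i (k - i))) t).
rewrite val_bexpr (_ : foldr _ _ _ = rmove i t); last by rewrite /rmove size_tuple.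
by move=> ->; rewrite rterm_rcons extE.
Qed.

Lemma lact1D a : {morph lact1 a : m n / m + n}.
Proof. by move=> m n; case: a => [|x [|y a]]; rewrite /lact1 /= ?lactD ?addr0. Qed.

Lemma lact1N a : {morph lact1 a : m / - m}.
Proof. by move=> m; case: a => [|x [|y a]]; rewrite /lact1 /= ?lactN ?oppr0. Qed.

Lemma lact1_sgn n a m : lact1 a (sgn n m) = sgn n (lact1 a m).
Proof. by rewrite !sgnE; case: odd; rewrite ?lact1N. Qed.

Lemma ract1D b : {morph ract1^~ b : m n / m + n}.
Proof. by move=> m n; case: b => [|x [|y b]]; rewrite /ract1 /= ?ractD ?addr0. Qed.

Lemma ract1N b : {morph ract1^~ b : m / - m}.
Proof. by move=> m; case: b => [|x [|y b]]; rewrite /ract1 /= ?ractN ?oppr0. Qed.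

Lemma ract1_sgn n b m : ract1 (sgn n m) b = sgn n (ract1 m b).
Proof. by rewrite !sgnE; case: odd; rewrite ?ract1N. Qed.

Lemma lract1 a m b : ract1 (lact1 a m) b = lact1 a (ract1 m b).
Proof.
case: a b => [|x [|y a]] [|z [|t b]]; rewrite /ract1 /lact1 /= ?ract0 ?lact0 //.
exact: lract.
Qed.

(** This is $t t = 0$: a word of two letters has two unshuffles into single letters, of opposite
    signs, with equal actions by [lact_braid]. *)
Lemma shsum_lact1_lact1 a m : shsum a (fun b c => lact1 b (lact1 c m)) = 0.
Proof.
have [a2|a2] := eqVneq (size a) 2; last first.
  apply: shsum0 => b c bc.
  by case: b bc => [|? [|? b]] //=; case: c => [|? [|? c]] //= bc;
     rewrite /lact1 /= ?lact0 //; case/eqP: a2.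
case: a a2 => [|x [|y []]] // _; rewrite /lact1 /=.
case E: (braiding (x, y)) => [y' x'] /=.
by rewrite !sgnE /= (lact_braid _ E) ?lact0 ?oppr0 ?addr0 ?add0r addNr.
Qed.

Lemma shsum_ract1_ract1 a m :
  shsum a (fun b c => sgn (size b) (ract1 (ract1 m b) c)) = 0.
Proof.
have [a2|a2] := eqVneq (size a) 2; last first.
  apply: shsum0 => b c bc.
  by case: b bc => [|? [|? b]] //=; case: c => [|? [|? c]] //= bc;
     rewrite /ract1 /= ?ract0 ?sgn0 //; case/eqP: a2.
case: a a2 => [|x [|y []]] // _; rewrite /ract1 /=.
case E: (braiding (x, y)) => [y' x'] /=.
by rewrite !sgnE /= (ract_braid _ E) ?ract0 ?oppr0 ?addr0 ?add0r ?opprK ?addNr ?subrr.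
Qed.

End Differential.

(** * Unshuffles into three blocks, the Leibniz rule and $d d = 0$ *)

Section TripleSums.
Variables (X : braidedSet) (V : zmodType).
Implicit Types (w a b c : seq X) (Phi Psi : seq X -> seq X -> seq X -> V).

(** A common form for iterated sums of both nestings, which lets identities be checked term by
    term. *)
Definition shsum3 w Phi := shsum w (fun a c => shsum a (fun a1 a2 => Phi a1 a2 c)).

Lemma eq_in_shsum3 w Phi Psi : (forall a b c, Phi a b c = Psi a b c) ->
  shsum3 w Phi = shsum3 w Psi.
Proof. by move=> eqP; do 2!apply: eq_shsum => ? ?. Qed.

Lemma shsum3D w Phi Psi :
  shsum3 w (fun a b c => Phi a b c + Psi a b c) = shsum3 w Phi + shsum3 w Psi.
Proof. by rewrite -shsumD; apply: eq_shsum => a c; rewrite shsumD. Qed.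

(* [h] may depend on the sizes, on which the sign of a term depends. *)
Lemma shsum3l (U : zmodType) w (Phi : seq X -> seq X -> U) h :
    (forall n c, {morph h n c : u v / u + v}) ->
  shsum w (fun a c => h (size a) c (shsum a Phi)) =
  shsum3 w (fun a b c => h (size a + size b)%N c (Phi a b) : V).
Proof.
move=> hD; apply: eq_shsum => a c; rewrite (shsum_additive _ _ (hD _ _)).
by apply: eq_in_shsum => a1 a2 ->.
Qed.

Lemma shsum3r (U : zmodType) w (Phi : seq X -> seq X -> U) h :
    (forall a, {morph h a : u v / u + v}) ->
  shsum w (fun a b => h a (shsum b Phi)) =
  shsum3 w (fun a b c => h a (Phi b c) : V).
Proof.
move=> hD; rewrite /shsum3 (shsum_coassoc w (fun a b c => h a (Phi b c))).
by apply: eq_shsum => a b; rewrite (shsum_additive _ _ (hD _)).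
Qed.

End TripleSums.

Section Leibniz.
Variables (X : braidedSet).
Implicit Types (w a b c : seq X).

(** The mixed terms $t F t$ cancel because the left and right actions commute; the others, [Phi] and
    [Psi], contain $t t$. *)
Lemma diffw_diffw (M : bimodule X) (F : seq X -> M) w : diffw (diffw F) w = 0.
Proof.
rewrite {1}/diffw.
rewrite (shsumD w (fun a b => lact1 a (diffw F b))
                  (fun a b => - sgn (size a) (ract1 (diffw F a) b))).
rewrite (shsum3r w _ (@lact1D _ M)).
rewrite (shsum3l w _ (h := fun n c m => - sgn n (ract1 m c))); last first.
  by move=> n c u v; rewrite ract1D sgnD opprD.
rewrite -shsum3D.
pose Phi a b c := lact1 a (lact1 b (F c)).
pose Psi a b c := sgn (size b) (ract1 (ract1 (F a) b) c).
transitivity (shsum3 w (fun a b c => Phi a b c + Psi a b c)).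
  apply: eq_in_shsum3 => a b c; rewrite /Phi /Psi.
  rewrite lact1D lact1N lact1_sgn ract1D ract1N ract1_sgn lract1 sgnD sgnN sgn_sgn.
  rewrite opprD opprK addrA; congr (_ + _); last first.
    by rewrite !sgnE !oddD; do 2!case: odd.
  rewrite -addrA -opprD; apply/eqP; rewrite addrC -subr_eq0 addrK oppr_eq0.
  (* Only a block [a] of one letter acts, so the two signs are opposite. *)
  case: a => [|x [|y a]]; rewrite /lact1 /= ?sgn0 ?addr0 //.
  by rewrite sgnS subrr.
rewrite shsum3D /shsum3 (shsum_coassoc w Psi) !shsum0 ?addr0 // => a b _.
  exact: shsum_ract1_ract1.
exact: shsum_lact1_lact1.
Qed.

(** The terms $\pm F t G$ of the two summands on the right cancel by [bmul_rlact], since $(F t) G =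
    F (t G)$. *)
Lemma diffw_cup (M : bimoduleAlgebra X) (F G : seq X -> M) w :
  diffw (cup F G) w =
  cup (diffw F) G w + cup (fun a => sgn (size a) (F a)) (diffw G) w.
Proof.
rewrite {1}/diffw.
rewrite (shsumD w (fun a b => lact1 a (cup F G b))
                  (fun a b => - sgn (size a) (ract1 (cup F G a) b))).
rewrite (shsum3r w _ (@lact1D _ M)).
rewrite (shsum3l w _ (h := fun n c m => - sgn n (ract1 m c))); last first.
  by move=> n c u v; rewrite ract1D sgnD opprD.
rewrite /cup (shsum3l w _ (h := fun n c m => bmul m (G c))); last first.
  by move=> n c u v; rewrite bmulDl.
rewrite (shsum3r w _ (h := fun a m => bmul (sgn (size a) (F a)) m)); last first.
  by move=> a u v; rewrite bmulDr.
rewrite -!shsum3D; apply: eq_in_shsum3 => a b c.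
have bsl n (m m' : M) : bmul (sgn n m) m' = sgn n (bmul m m').
  by rewrite !sgnE; case: odd; rewrite ?bmulNl.
have bsr n (m m' : M) : bmul m (sgn n m') = sgn n (bmul m m').
  by rewrite !sgnE; case: odd; rewrite ?bmulNr.
rewrite bmulDl bmulDr bmulNl bmulNr !bsl !bsr !sgn_sgn.
have -> : bmul (lact1 a (F b)) (G c) = lact1 a (bmul (F b) (G c)).
  by case: a => [|x [|y a]]; rewrite /lact1 /= ?bmul_lact ?bmul0l.
have -> : bmul (F a) (ract1 (G b) c) = ract1 (bmul (F a) (G b)) c.
  by case: c => [|x [|y c]]; rewrite /ract1 /= ?bmul_ract ?bmul0r.
have -> : bmul (F a) (lact1 b (G c)) = bmul (ract1 (F a) b) (G c).
  by case: b => [|x [|y b]]; rewrite /ract1 /lact1 /= ?bmul_rlact ?bmul0r ?bmul0l.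
by rewrite addrA subrK.
Qed.

Theorem cochain_dg_algebra (M : bimoduleAlgebra X) :
  dg_algebra (A := cochain M) (@diff X M) (@smile X M).
Proof.
split; first exact: cochain_graded_algebra.
- move=> k f g; rewrite -{1}[g]opprK diffB; congr (_ + _).
  by rewrite -[- g]add0r diffB diff0 add0r opprK.
- move=> k f; apply: ext_inj => w; rewrite ext0 ext_diff.
  rewrite -[RHS](diffw_diffw (ext f) w); apply: eq_shsum => a b.
  by rewrite !ext_diff.
move=> p q f g; apply: ext_inj => w.
rewrite extD ext_sgn ext_diff (_ : ext _ w = cup (diffw (ext f)) (ext g) w); last first.
  by rewrite (ext_smile (diff f) g); apply: eq_cup => // a; apply: ext_diff.
transitivity (diffw (cup (ext f) (ext g)) w).
  by apply: eq_shsum => a b; rewrite !ext_smile.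
rewrite diffw_cup; congr (_ + _); rewrite ext_gcast ext_smile /cup -shsum_sgn.
apply: eq_shsum => a b; rewrite ext_diff.
have [->|ap] := eqVneq (size a) p.
  by rewrite !sgnE; case: odd; rewrite ?bmulNl.
by rewrite ext_out ?sgn0 ?bmul0l ?sgn0 //; apply/eqP.
Qed.

End Leibniz.

Lemma split_nth (T : Type) i (w : seq T) : (i < size w)%N ->
  exists a x b, w = a ++ x :: b /\ size a = i.
Proof.
move=> iw; case: w iw => // x0 w iw; exists (take i (x0 :: w)).
exists (nth x0 (x0 :: w) i), (drop i.+1 (x0 :: w)).
by rewrite -drop_nth // cat_take_drop size_takel // ltnW.
Qed.

(** * Precubical structure *)

Section CubicalFaces.
Variable X : braidedSet.
Implicit Types (x y z : X) (w a b : seq X) (e : bool) (i j m : nat).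
Local Notation sigma := (@braiding X).

(** The action of $b_1 \cdots b_k$ on the word $w x$, with the outgoing letter kept apart. *)
Fixpoint pull w x : X * seq X :=
  if w is y :: t then
    let: (x', t') := pull t x in
    let: (x'', y') := sigma (y, x') in (x'', y' :: t')
  else (x, [::]).

Lemma size_pull w x : size (pull w x).2 = size w.
Proof.
elim: w => //= y w; case: (pull w x) => x' w' /=.
by case: (sigma _) => x'' y' /= ->.
Qed.

Lemma pull_cat a b x :
  pull (a ++ b) x =
  let: (x', b') := pull b x in let: (x'', a') := pull a x' in (x'', a' ++ b').
Proof.
elim: a => [|y a IHa] /=; first by case: (pull b x).
rewrite IHa; case: (pull b x) => x' b'; case: (pull a x') => x'' a'.
by case: (sigma _).
Qed.

Lemma pull_pull w x y :
  let: (x1, w1) := pull w x in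
  let: (y1, w2) := pull w1 y in
  let: (y', x') := sigma (x, y) in
  let: (y2, w3) := pull w y' in
  let: (x2, w4) := pull w3 x' in
  w2 = w4 /\ sigma (x1, y1) = (y2, x2).
Proof.
elim: w => [|z w] /=; first by case: (sigma (x, y)).
case: (pull w x) => x1 w1 /=.
case E1: (sigma (z, x1)) => [x1' z1] /=; case: (pull w1 y) => y1 w2.
case E2: (sigma (z1, y1)) => [y1' z2]; case: (sigma (x, y)) => y' x'.
case: (pull w y') => y2 w3; case E3: (sigma (z, y2)) => [y2' z3] /=.
case: (pull w3 x') => x2 w4; case E4: (sigma (z3, x2)) => [x2' z4] [-> E5].
have := yang_baxterE z x1 y1; rewrite E1 E2 E5 E3 E4.
by case: (sigma (x1', y1')) => ? ? [-> -> ->].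
Qed.

(** With $x$ going right and $y$ going left through $w$, they may meet at either end of $w$. *)
Lemma push_pull x w y :
  let: (y1, w1) := pull w y in
  let: (y2, x1) := sigma (x, y1) in
  let: (w2, x2) := push x1 w1 in
  let: (v1, x3) := push x w in
  let: (z1, x4) := sigma (x3, y) in
  let: (z2, v2) := pull v1 z1 in
  [/\ y2 = z2, w2 = v2 & x2 = x4].
Proof.
elim: w x => [|z w IHw] x /=; first by case: (sigma (x, y)) => ? ?.
case E0: (sigma (x, z)) => [z0 x0]; have := IHw x0.
case: (pull w y) => y1 w1; case E1: (sigma (x0, y1)) => [y2 x1].
case E2: (push x1 w1) => [w2 x2]; case: (push x0 w) => v1 x3.
case E3: (sigma (x3, y)) => [z1 x4] /=; case: (pull v1 z1) => z2 v2 [? ? ?]; subst.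
case E4: (sigma (z0, z2)) => [y3 z3].
have := yang_baxterE x z y1; rewrite E0 E1 E4.
case: (sigma (z, y1)) => y4 z4; case E5: (sigma (x, y4)) => [y5 x5].
by case E6: (sigma (x5, z4)) => [z6 x6] [? ? ?]; subst; rewrite /= E6 E2.
Qed.

Definition face e i w : seq X :=
  if e then behead (lmove i w)
  else if rmove i w is x :: a then belast x a else [::].
Arguments face : simpl never.

Lemma lmove_cat a x b :
  lmove (size a) (a ++ x :: b) = (pull a x).1 :: (pull a x).2 ++ b.
Proof.
elim: a => //= y a IHa; rewrite lmove_cons IHa.
by case: (pull a x) => x' a' /=; case: (sigma _).
Qed.

Lemma rmove_cat a x b :
  rmove (size a) (a ++ x :: b) = a ++ rcons (push x b).1 (push x b).2.
Proof.
elim: a => [|y a IHa] /=; first exact: rmove0.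
by rewrite rmove_cons ?IHa // size_cat /= addnS ltnS leq_addr.
Qed.

Lemma lface_cat a x b : face true (size a) (a ++ x :: b) = (pull a x).2 ++ b.
Proof. by rewrite /face lmove_cat. Qed.

Lemma rface_cat a x b : face false (size a) (a ++ x :: b) = a ++ (push x b).1.
Proof.
rewrite /face rmove_cat -rcons_cat.
by case: (a ++ _) => //= y t; rewrite belast_rcons.
Qed.

Lemma size_face e i w : (i < size w)%N -> size (face e i w) = (size w).-1.
Proof.
rewrite /face; case: e => _; first by rewrite size_behead size_lmove.
by have := size_rmove i w; case: (rmove i w) => [|x a] <- //=; rewrite size_belast.
Qed.

Lemma lface_rface_cat e a b c x y :
  face e (size a) (face false (size a + size b).+1 (a ++ x :: b ++ y :: c)) =
  face false (size a + size b) (face e (size a) (a ++ x :: b ++ y :: c)).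
Proof.
have -> : a ++ x :: b ++ y :: c = (a ++ x :: b) ++ y :: c by rewrite -catA.
rewrite [(_ + _).+1](_ : _ = size (a ++ x :: b));
  last by rewrite size_cat /= addnS.
rewrite rface_cat -!catA /=; case: e.
  rewrite !lface_cat -(size_pull a x) -size_cat [in RHS]catA rface_cat.
  by rewrite -catA.
rewrite !rface_cat !push_cat /=.
case: (push x b) (size_push x b) => b' x' /= sb.
case E: (sigma (x', y)) => [y' x''].
have := push_push x' y c; rewrite E.
case E1: (push y c) => [c1 y1] /=; case E2: (push x' c1) => [c2 x2] /=.
case E3: (push x'' c) => [c3 x3] /=; case E4: (push y' c3) => [c4 x4] /= [ec _].
by rewrite -sb -size_cat [in RHS]catA rface_cat E4 /= ec -catA.
Qed.

Lemma face_lface_cat e a b c x y :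
  face e (size a) (face true (size a + size b).+1 (a ++ x :: b ++ y :: c)) =
  face true (size a + size b) (face e (size a) (a ++ x :: b ++ y :: c)).
Proof.
have -> : a ++ x :: b ++ y :: c = (a ++ x :: b) ++ y :: c by rewrite -catA.
rewrite [(_ + _).+1](_ : _ = size (a ++ x :: b));
  last by rewrite size_cat /= addnS.
rewrite lface_cat pull_cat /=.
case E1: (pull b y) (size_pull b y) => [y1 b1] /= sb.
case E2: (sigma (x, y1)) => [y2 x1] /=.
case E3: (pull a y2) (size_pull a y2) => [y3 a1] /= sa; rewrite -sa -catA /=.
case: e; rewrite (lface_cat, rface_cat) sa -?catA /=.
  have := pull_pull a x y1; rewrite lface_cat.
  case E4: (pull a x) (size_pull a x) => [x2 a2] /= sa2.
  rewrite -sa2 -size_cat [in RHS]catA lface_cat pull_cat E1 E2 E3.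
  by case: (pull a2 y1) => y4 a3; case: (pull a1 x1) => x3 a4 [-> _]; rewrite catA.
have := push_pull x b y; rewrite rface_cat !push_cat /= E1 E2.
case E4: (push x1 b1) => [b2 x2] /=.
case E5: (push x b) (size_push x b) => [b3 x3] /= sb3.
case E6: (sigma (x3, y)) => [y4 x4]; case E7: (pull b3 y4) => [y5 b4].
case=> ? ? ?; subst; case E8: (push x4 c) => [c1 x5] /=.
rewrite -sb3 -size_cat [in RHS]catA lface_cat pull_cat E7 E3 /=.
by rewrite catA.
Qed.

(** The precubical identity. An earlier letter leaving to the left and a later one leaving to the
    right do not interact; the three other cases are [push_push], [pull_pull] and [push_pull]. *)
Lemma face_face e e' i j w : (i <= j)%N -> (j.+1 < size w)%N ->
  face e i (face e' j.+1 w) = face e' j (face e i w).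
Proof.
move=> ij jw; have [a [x [d [wE sa]]]] := split_nth (leq_ltn_trans ij (ltnW jw)).
have [|b [y [c [dE sb]]]] := @split_nth _ (j - i) d.
  by move: jw; rewrite wE size_cat /= sa; lia.
rewrite wE dE -sa (_ : j = size a + size b)%N; last by rewrite sa sb subnKC.
by case: e'; rewrite ?face_lface_cat ?lface_rface_cat.
Qed.

(* A label keeps a letter ([None]) or moves it out of the word to the left    *)
(* ([Some true]) or to the right ([Some false]); [v] labels the letters from  *)
(* position [m] on.                                                           *)
Fixpoint faces m (v : seq (option bool)) w : seq X :=
  match v with
  | [::] => w
  | None :: v' => faces m.+1 v' w
  | Some e :: v' => face e m (faces m.+1 v' w)
  end.

End CubicalFaces.
Arguments face {X} e i w : simpl never.

Local Notation keeps v := (count (fun l : option bool => ~~ isSome l) v).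

Fixpoint insert_face j e (v : seq (option bool)) :=
  match j, v with
  | j'.+1, l :: v' => l :: insert_face j' e v'
  | _, _ => Some e :: v
  end.

Section LabelledFaces.
Variable X : braidedSet.
Implicit Types (x y z : X) (w a b : seq X) (e : bool) (i j m : nat).
Implicit Types (u v : seq (option bool)).

Lemma size_faces m v w : (m + size v <= size w)%N ->
  (size (faces m v w) + size v = size w + keeps v)%N.
Proof.
elim: v m => [|[e|] v IHv] m /=; rewrite ?addn0 // addnS -addSn => mw.
  have := IHv _ mw; rewrite size_face; last by have := IHv _ mw; lia.
  by have := IHv _ mw; lia.
by have := IHv _ mw; lia.
Qed.

Lemma faces_face m v e i w : (i <= m)%N -> (m + size v < size w)%N ->
  faces m v (face e i w) = face e i (faces m.+1 v w).
Proof.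
elim: v m => //= -[e'|] v IHv m im; rewrite addnS -addSn => mw; last first.
  by apply: IHv mw; apply: leqW.
rewrite IHv ?leqW // face_face //.
by have := @size_faces m.+2 v w; rewrite addSn; move/(_ mw); move: mw; lia.
Qed.

(** The removal made first is slid behind those at later positions by [face_face]. *)
Lemma faces_insert m v e j w : (j <= size v)%N -> (m + size v < size w)%N ->
  faces m v (face e (m + j) w) = faces m (insert_face j e v) w.
Proof.
elim: j m v => [|j IHj] m v jv mw.
  by rewrite addn0 faces_face //; case: v {jv mw}.
case: v jv mw => //= l v jv; rewrite addnS -addSn => mw.
by case: l => [e'|]; rewrite -IHj // addSnnS.
Qed.

Lemma faces_cons m v x w : Some true \notin v -> (m + size v <= size w)%N ->
  faces m.+1 v (x :: w) = x :: faces m v w.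
Proof.
elim: v m => //= l v IHv m; rewrite inE negb_or addnS -addSn => /andP[ml mv] mw.
case: l ml => [[]|] // _; rewrite IHv //.
rewrite /face rmove_cons; last by have := size_faces mw; move: mw; lia.
case E: (rmove _ _) => [|y a] //=.
have := size_rmove m (faces m.+1 v w); rewrite E /=.
by have := size_faces mw; move: mw; lia.
Qed.

Definition cross a b := foldl (fun a y => (pull a y).2) a b.

(** [cross] treats the letters of [b] one by one; this decomposes the same crossing along [a]. *)
Lemma cross_rcons a x b :
  cross (rcons a x) b = rcons (cross a (push x b).1) (push x b).2.
Proof.
rewrite /cross; elim: b a x => //= y b IHb a x.
rewrite -cats1 pull_cat /=; case: (braiding _) => y' x' /=.
case E: (pull a y') => [y'' a']; rewrite cats1 IHb.
by case: (push x' b) => b' x'' /=; rewrite E.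
Qed.

(** The letters kept by [u] are those which [v] moves out to the left. They cross the prefix [a] in
    the shape given by [faces 0 u w]. An arbitrary prefix is what the induction requires. *)
Lemma faces_dual a (v u : seq (option bool)) w : size u = size w ->
    Some true \notin u ->
    v = [seq if l is None then Some true else None | l <- u] ->
  faces (size a) v (a ++ w) = cross a (faces 0 u w) ++ faces 0 v w.
Proof.
move=> + + ->; elim: w a u => [|y w IHw] a [|l u] // [uw].
rewrite inE negb_or => /andP[lt ut].
have uw0 : (0 + size u <= size w)%N by rewrite uw.
case: l lt => [[]|] //= _.
  rewrite -cat_rcons -(size_rcons a y) IHw // faces_cons //.
  rewrite (IHw [:: y] _ uw ut) [face false 0 _](rface_cat [::]) /=.
  have cross0 b : cross [::] b = [::] by elim: b.
  by rewrite cross_rcons (cross_rcons [::]) cross0 cat_rcons.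
rewrite -faces_face ?size_map ?size_cat ?uw ?addnS //.
rewrite lface_cat -{1}(size_pull a y) IHw // faces_cons //=.
by rewrite -[in RHS]faces_face ?size_map /= ?uw.
Qed.

End LabelledFaces.

(** * The cup-1 homotopy on the cube *)

Section LabelSums.
Variable K : comPzRingType.
Local Notation label := (option bool).
Implicit Types (u v : seq label) (e : bool) (n i : nat).
Implicit Types (phi : seq label -> K) (Phi Psi : seq label -> seq label -> K).

(** One interval factor of the diagonal ([e = true]) or of its transpose ([e = false]): one copy
    keeps the letter, the other takes an end. The Koszul sign comes from a kept letter passing the
    cell [u]. *)
Definition step e Phi u v : K := Phi (None :: u) (Some e :: v)
  + sgn (keeps u) (Phi (Some (~~ e) :: u) (None :: v)).

Fixpoint cupL e n Phi : K :=
  if n is n'.+1 then cupL e n' (step e Phi) else Phi [::] [::].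

Definition diag Phi u v : K := sgn (keeps u) (Phi (None :: u) (None :: v)).

(* The homotopy of the n-cube is the sum over i of the tensor products        *)
(* [D (x) .. (x) D (x) h (x) D' (x) .. (x) D'], where [D] is the diagonal of  *)
(* the interval [I], [D'] is its transpose, and [h I = I (x) I] is in place i.*)
Fixpoint cup1L n Phi : K :=
  if n is n'.+1 then
    cupL false n' (diag Phi) - cup1L n' (step true Phi)
  else 0.

Lemma eq_in_cupL e n Phi Psi :
    (forall u v, size u = n -> Some e \notin u ->
      v = [seq if l is None then Some e else None | l <- u] ->
      Phi u v = Psi u v) ->
  cupL e n Phi = cupL e n Psi.
Proof.
elim: n Phi Psi => [|n IHn] Phi Psi eqP /=; first exact: eqP.
apply: IHn => u v un eu uv; rewrite /step !eqP ?inE ?negb_or /= ?un ?uv //.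
by case: e {eqP uv} eu.
Qed.

Lemma eq_cupL e n Phi Psi :
    (forall u v, size u = n -> size v = n -> Phi u v = Psi u v) ->
  cupL e n Phi = cupL e n Psi.
Proof. by move=> eqP; apply: eq_in_cupL => u v un _ ->; rewrite eqP ?size_map. Qed.

Lemma cupLD e n Phi Psi :
  cupL e n (fun u v => Phi u v + Psi u v) = cupL e n Phi + cupL e n Psi.
Proof.
elim: n Phi Psi => //= n IHn Phi Psi; rewrite -IHn; apply: eq_cupL => u v _ _.
by rewrite /step sgnD addrACA.
Qed.

Lemma cupLN e n Phi : cupL e n (fun u v => - Phi u v) = - cupL e n Phi.
Proof.
elim: n Phi => //= n IHn Phi; rewrite -IHn; apply: eq_cupL => u v _ _.
by rewrite /step sgnN opprD.
Qed.

Lemma eq_cup1L n Phi Psi :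
    (forall u v, size u = n -> size v = n -> Phi u v = Psi u v) ->
  cup1L n Phi = cup1L n Psi.
Proof.
elim: n Phi Psi => //= n IHn Phi Psi eqP; congr (_ - _).
  by apply: eq_cupL => u v un vn; rewrite /diag eqP //= ?un ?vn.
by apply: IHn => u v un vn; rewrite /step !eqP //= ?un ?vn.
Qed.

Lemma cup1LD n Phi Psi :
  cup1L n (fun u v => Phi u v + Psi u v) = cup1L n Phi + cup1L n Psi.
Proof.
elim: n Phi Psi => [|n IHn] Phi Psi /=; first by rewrite addr0.
rewrite addrACA -opprD -IHn -cupLD; congr +%R; last congr -%R.
  by apply: eq_cupL => u v _ _; rewrite /diag sgnD.
by apply: eq_cup1L => u v _ _; rewrite /step sgnD addrACA.
Qed.

Lemma cup1LN n Phi : cup1L n (fun u v => - Phi u v) = - cup1L n Phi.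
Proof.
elim: n Phi => [|n IHn] Phi /=; first by rewrite oppr0.
rewrite opprD -[in RHS]IHn -[in RHS]cupLN; congr +%R; last congr -%R.
  by apply: eq_cupL => u v _ _; rewrite /diag sgnN.
by apply: eq_cup1L => u v _ _; rewrite /step sgnN opprD.
Qed.

Lemma cup1L0 n : cup1L n (fun _ _ => 0) = 0.
Proof. by apply: (addIr (cup1L n (fun _ _ => 0))); rewrite -cup1LD !add0r. Qed.

Lemma cupL_swap n Phi :
  cupL true n (fun u v => sgn (keeps u * keeps v) (Phi v u)) = cupL false n Phi.
Proof.
elim: n Phi => [|n IHn] Phi /=; first by rewrite sgnE.
rewrite -IHn; apply: eq_cupL => u v _ _; rewrite /step /= sgnD !sgn_sgn addrC.
by congr (_ + _); rewrite !sgnE !(oddD, oddM) /=;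
  case: (odd (keeps u)); case: (odd (keeps v)).
Qed.

(** Evaluates [phi] on the boundary of the cell labelled [u], whose directions are the kept
    letters. *)
Fixpoint coface_sum phi u : K :=
  match u with
  | [::] => 0
  | None :: u' => phi (Some true :: u') - phi (Some false :: u')
      - coface_sum (fun t => phi (None :: t)) u'
  | Some e :: u' => coface_sum (fun t => phi (Some e :: t)) u'
  end.

Lemma eq_coface_sum phi psi u : phi =1 psi -> coface_sum phi u = coface_sum psi u.
Proof.
elim: u phi psi => //= -[e|] u IHu phi psi eqp; last first.
  by rewrite !eqp; congr (_ - _); apply: IHu => t; rewrite eqp.
by apply: IHu => t; rewrite eqp.
Qed.

Lemma coface_sumD phi psi u :
  coface_sum (fun t => phi t + psi t) u = coface_sum phi u + coface_sum psi u.
Proof.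
elim: u phi psi => [|[e|] u IHu] phi psi /=; rewrite ?addr0 ?IHu //.
ring.
Qed.

Lemma coface_sum_sgn n phi u :
  coface_sum (fun t => sgn n (phi t)) u = sgn n (coface_sum phi u).
Proof.
elim: u phi => [|[e|] u IHu] phi /=; rewrite ?sgn0 ?IHu //.
by rewrite !sgnE; case: odd => //; ring.
Qed.

Lemma coface_sum_keeps phi u :
  coface_sum (fun t => sgn (keeps t) (phi t)) u = - sgn (keeps u) (coface_sum phi u).
Proof.
elim: u phi => [|[e|] u IHu] phi /=; rewrite ?sgn0 ?oppr0 ?add0n ?IHu //.
rewrite (@eq_coface_sum _ (fun t => sgn (keeps t) (- phi (None :: t)))); last first.
  by move=> t /=; rewrite sgnS sgnN.
rewrite IHu (@eq_coface_sum _ (fun t => sgn 1 (phi (None :: t)))); last first.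
  by move=> t; rewrite sgnE.
rewrite coface_sum_sgn !sgnE /=; case: odd => /=; ring.
Qed.

Definition coface_sum2 Phi u v : K :=
  coface_sum (Phi^~ v) u + sgn (keeps u) (coface_sum (Phi u) v).

(** The diagonal of the interval is a chain map: the boundary of $D I$ is the difference of the
    diagonals of the two ends. The last minus sign is that of a boundary passing $I$. *)
Lemma step_coface_sum2 e Phi u v :
  step e (coface_sum2 Phi) u v =
  Phi (Some true :: u) (Some true :: v) - Phi (Some false :: u) (Some false :: v)
  - coface_sum2 (step e Phi) u v.
Proof.
rewrite /step /coface_sum2 /= !coface_sumD coface_sum_sgn coface_sum_keeps.
rewrite !sgnE /=; case: e => /=; case: odd => /=; ring.
Qed.

(** On the interval, the boundary of $I \otimes I$ is $D' I - D I$. *)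
Lemma diag_coface_sum2 Phi u v :
  diag (coface_sum2 Phi) u v - coface_sum2 (diag Phi) u v =
  step false Phi u v - step true Phi u v.
Proof.
rewrite /diag /step /coface_sum2 /= coface_sum_keeps coface_sum_sgn.
rewrite !sgnE /=; case: odd => /=; ring.
Qed.

Definition insert2 i e Phi u v : K := Phi (insert_face i e u) (insert_face i e v).

Lemma keeps_insert i e u : keeps (insert_face i e u) = keeps u.
Proof. by elim: i u => [|i IHi] [|l u] //=; rewrite IHi. Qed.

(* Evaluates [A] on the boundary of the top cell of the n-cube. *)
Definition face_sum (A : nat -> (seq label -> seq label -> K) -> K) n Phi : K :=
  \sum_(i < n) sgn i (A n.-1 (insert2 i true Phi) - A n.-1 (insert2 i false Phi)).

Lemma face_sum_cupL e n Phi :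
  face_sum (cupL e) n Phi = cupL e n (coface_sum2 Phi).
Proof.
elim: n Phi => [|n IHn] Phi.
  by rewrite /face_sum big_ord0 /coface_sum2 /= sgnE addr0.
transitivity (cupL e n (insert2 0 true Phi) - cupL e n (insert2 0 false Phi)
              - face_sum (cupL e) n (step e Phi)).
  rewrite /face_sum big_ord_recl sgnE /= -sumrN; congr (_ + _).
  apply: eq_bigr => i _; rewrite sgnS; congr (- sgn _ _).
  case: n i {IHn} => [[]//|n i] /=.
  by congr (_ - _); apply: eq_cupL => u v _ _; rewrite /step /insert2 /= keeps_insert.
rewrite IHn -!cupLN -!cupLD; apply: eq_cupL => u v _ _.
by rewrite step_coface_sum2.
Qed.

(** Induction on the first direction. There $h$ contributes $D' \otimes D' - D \otimes D'$, while
    $D$ followed by the homotopy in the other directions contributes $D \otimes D' - D \otimes D$;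
    the sum telescopes. *)
Lemma cup1L_homotopy n Phi :
  face_sum cup1L n Phi + cup1L n (coface_sum2 Phi) =
  cupL false n Phi - cupL true n Phi.
Proof.
elim: n Phi => [|n IHn] Phi; first by rewrite /face_sum big_ord0 addr0 subrr.
have -> : face_sum cup1L n.+1 Phi =
    cup1L n (insert2 0 true Phi) - cup1L n (insert2 0 false Phi)
    + face_sum cup1L n (step true Phi) - face_sum (cupL false) n (diag Phi).
  rewrite /face_sum big_ord_recl sgnE /= -[RHS]addrA -sumrB; congr (_ + _).
  apply: eq_bigr => i _; rewrite sgnS -sgnN -sgnN -sgnD; congr sgn.
  case: n i {IHn} => [[]//|n i] /=.
  have insS e : cup1L n.+1 (insert2 i.+1 e Phi) =
      cupL false n (insert2 i e (diag Phi)) - cup1L n (insert2 i e (step true Phi)).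
    rewrite /=; congr (_ - _).
      by apply: eq_cupL => u v _ _; rewrite /diag /insert2 /= keeps_insert.
    by apply: eq_cup1L => u v _ _; rewrite /step /insert2 /= keeps_insert.
  rewrite -[fintype.bump 0 i]/(i.+1) -/(cup1L n.+1 _) -/(cup1L n.+1 _) !insS; ring.
rewrite face_sum_cupL /=.
have -> : cup1L n (step true (coface_sum2 Phi)) =
    cup1L n (insert2 0 true Phi) - cup1L n (insert2 0 false Phi)
    - cup1L n (coface_sum2 (step true Phi)).
  rewrite -!cup1LN -!cup1LD; apply: eq_cup1L => u v _ _.
  exact: step_coface_sum2.
have -> : cupL false n (diag (coface_sum2 Phi)) =
    cupL false n (coface_sum2 (diag Phi)) + cupL false n (step false Phi)
    - cupL false n (step true Phi).
  rewrite -!cupLN -!cupLD; apply: eq_cupL => u v _ _.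
  by apply/eqP; rewrite -addrA addrC -subr_eq diag_coface_sum2.
have := IHn (step true Phi).
set a := face_sum _ _ _; set b := cup1L n (coface_sum2 _).
move/(canRL (addrK _)) => ->; ring.
Qed.

End LabelSums.

(** * The cup-1 product for trivial coefficients *)

Section TrivialCoefficients.
Variables (X : braidedSet) (K : comPzRingType).
Implicit Types (w a b : seq X) (F G : seq X -> K).
Let M := trivial_algebra X K.

(** The first block is what remains when the letters of the second leave to the right, and the
    second what remains when those of the first leave to the left. *)
Lemma shsum_faces w (Phi : seq X -> seq X -> K) :
  shsum w Phi =
  cupL true (size w) (fun u v => Phi (faces 0 u w) (faces 0 v w)).
Proof.
elim: w Phi => //= x w IHw Phi; rewrite IHw.
apply: eq_in_cupL => u v un ut uv; rewrite /step /=.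
have un0 : (0 + size u <= size w)%N by rewrite un.
have vn : size v = size w by rewrite uv size_map.
have szA : keeps u = size (faces 0 u w) by have := size_faces un0; lia.
rewrite faces_cons // -(faces_face _ (leqnn 0)) /= ?vn //.
rewrite [face true 0 _](lface_cat [::]) [face false 0 _](rface_cat [::]) /=.
have := @faces_dual X [:: x] v u w un ut uv; rewrite /= => ->.
have cross0 b : cross [::] b = [::] by elim: b.
by rewrite (cross_rcons [::]) cross0 szA.
Qed.

Lemma diffw_trivial F w : diffw (M := M) F w =
  \sum_(i < size w) sgn i (F (face true i w) - F (face false i w)).
Proof.
rewrite diffwE; apply: eq_bigr => i _; congr (sgn i (_ - _)); rewrite /face.
  case E: (lmove i w) => //=; have := size_lmove i w; rewrite E /=.
  by have := ltn_ord i; lia.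
case E: (rmove i w) => //=; have := size_rmove i w; rewrite E /=.
by have := ltn_ord i; lia.
Qed.

Lemma coface_sum_faces F m u w : (m + size u <= size w)%N ->
  coface_sum (fun t => F (faces m t w)) u =
  \sum_(j < keeps u) sgn j (F (face true (m + j) (faces m u w))
                            - F (face false (m + j) (faces m u w))).
Proof.
elim: u m F => [|l u IHu] m F /=; first by rewrite big_ord0.
rewrite addnS -addSn => mw; have szu := size_faces mw.
case: l => [e|] /=.
  rewrite (IHu _ (fun b => F (face e m b))) // add0n; apply: eq_bigr => j _.
  by rewrite addSn !face_face ?leq_addr //; have := ltn_ord j; move: mw; lia.
rewrite (IHu _ F) // big_ord_recl addn0 sgnE /= -sumrN; congr (_ + _).
by apply: eq_bigr => j _; rewrite sgnS addSnnS.
Qed.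

Lemma coface_sum_cocycle F u w : size u = size w ->
  (forall b, diffw (M := M) F b = 0) -> coface_sum (fun t => F (faces 0 t w)) u = 0.
Proof.
move=> un F0; have un0 : (0 + size u <= size w)%N by rewrite un.
rewrite coface_sum_faces // -[RHS](F0 (faces 0 u w)) diffw_trivial.
by rewrite (_ : keeps u = size (faces 0 u w)) //; have := size_faces un0; lia.
Qed.

Definition cup1 F G w : K :=
  cup1L (size w) (fun u v => F (faces 0 u w) * G (faces 0 v w)).

(** In [cup1L_homotopy] the term with [coface_sum2] applies the differential to [F] or to [G] on a
    face of [w], so it vanishes for cocycles. *)
Lemma diffw_cup1 F G w :
    (forall a, diffw (M := M) F a = 0) -> (forall a, diffw (M := M) G a = 0) ->
  diffw (M := M) (cup1 F G) w =
  shsum w (fun a b => sgn (size a * size b) (F b * G a)) - cup (M := M) F G w.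
Proof.
move=> F0 G0; rewrite diffw_trivial.
pose Phi u v := F (faces 0 u w) * G (faces 0 v w).
transitivity (face_sum (@cup1L K) (size w) Phi).
  apply: eq_bigr => i _; congr sgn; have iw := ltn_ord i.
  by congr (_ - _); rewrite /cup1 size_face //; apply: eq_cup1L => u v un vn;
     rewrite -[i : nat]add0n !faces_insert ?un ?vn //; lia.
have := cup1L_homotopy (size w) Phi.
rewrite (@eq_cup1L _ _ (coface_sum2 Phi) (fun _ _ => 0)) => [|u v un vn]; last first.
  rewrite /coface_sum2 /Phi.
  (* With the other factor fixed, the product is a scalar multiple of a cocycle. *)
  rewrite (coface_sum_cocycle (F := fun a => F a * G (faces 0 v w))) //; last first.
    move=> b; have := congr1 (fun z : K => z * G (faces 0 v w)) (F0 b).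
    rewrite mul0r !diffw_trivial mulr_suml; apply: etrans; apply: eq_bigr => i _.
    by rewrite !sgnE; case: odd; ring.
  rewrite (coface_sum_cocycle (F := fun a => F (faces 0 u w) * G a)) ?sgn0 ?addr0 //.
  move=> b; have := congr1 (fun z : K => F (faces 0 u w) * z) (G0 b).
  rewrite mulr0 !diffw_trivial mulr_sumr; apply: etrans; apply: eq_bigr => i _.
  by rewrite !sgnE; case: odd; ring.
rewrite cup1L0 addr0 => ->; rewrite /cup !shsum_faces -cupL_swap; congr (_ - _).
apply: eq_cupL => u v un vn; rewrite /Phi.
have szK t : size t = size w -> keeps t = size (faces 0 t w).
  move=> tn; have tn0 : (0 + size t <= size w)%N by rewrite tn.
  by have := size_faces tn0; lia.
by rewrite -!szK.
Qed.

End TrivialCoefficients.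

(** * Cohomology *)

Section Cohomology.
Variables (X : braidedSet).

Lemma eq_in_diffw (M : bimodule X) (F G : seq X -> M) w :
    (forall a, (size a).+1 = size w -> F a = G a) -> diffw F w = diffw G w.
Proof.
move=> FG; rewrite !diffwE; apply: eq_bigr => i _; congr (sgn i (_ - _)).
  by have := size_lmove i w; case: (lmove i w) => //= x a aw; rewrite FG.
have := size_rmove i w; case: (rmove i w) => //= x a aw.
by rewrite FG ?size_belast.
Qed.

(** Degree 0 is included because [diffw] vanishes on the empty word. *)
Lemma is_coboundaryI (M : bimodule X) k (f : cochain M k) (F : seq X -> M) :
  (forall w, size w = k -> ext f w = diffw F w) -> is_coboundary f.
Proof.
case: k f => [|k] f fF /=.
  apply: ext_inj => w; rewrite ext0; case: w => [|x w].
    by rewrite fF // diffwE big_ord0.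
  by rewrite ext_out.
exists (fun t => F t); apply: ext_inj => w; rewrite ext_diff.
have [wk|wk] := eqVneq (size w) k.+1; last first.
  rewrite -ext_diff !ext_out //; exact/eqP.
rewrite fF //; apply: eq_in_diffw => a; rewrite wk => -[ak].
have [t ->] : exists t : k.-tuple X, a = t by exists (Tuple (introT eqP ak)).
by rewrite extE.
Qed.

Lemma is_coboundaryE (M : bimodule X) k (f : cochain M k) :
  is_coboundary f -> exists F, ext f =1 diffw F.
Proof.
case: k f => [|k] f /= => [->|[g ->]]; last by exists (ext g); apply: ext_diff.
exists (fun _ => 0) => w; rewrite ext0 diffwE big1 // => i _.
rewrite /lterm /rterm; case: lmove => [|x a]; case: rmove => [|y b];
  by rewrite ?lact0 ?ract0 subrr sgn0.
Qed.

Section Classes.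
Variables (M : bimodule X) (k : nat).
Implicit Types z : cocycles M k.

Lemma diff_cocycle z : diff (z : cochain M k) = 0.
Proof. by case: z => f /=; rewrite unfold_in => /eqP. Qed.

Lemma coho_class_eqP z z' :
  coho_class z = coho_class z' <-> is_coboundary (z - z' : cochain M k).
Proof.
have -> : coho_class z = coho_class z' <-> z - z' \in @coboundary X M k.
  by rewrite Quotient.idealrBE; split=> [/eqP|/eqP].
by rewrite unfold_in; split=> [/asboolP|cob]; last exact/asboolP.
Qed.

Lemma coho_classD z z' : coho_class (z + z') = coho_class z + coho_class z'.
Proof. exact: raddfD. Qed.

Lemma coho_classN z : coho_class (- z) = - coho_class z.
Proof. exact: raddfN. Qed.

End Classes.

Lemma coho_class_sgn (M : bimodule X) k n (z : cocycles M k) :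
  coho_class (z *~ (-1) ^+ n) = coho_class z *~ (-1) ^+ n.
Proof.
rewrite -/(sgn n z) -/(sgn n (coho_class z)) !sgnE.
by case: odd; rewrite ?coho_classN.
Qed.

Lemma cocycle_val_sgn (M : bimodule X) k n (z : cocycles M k) :
  (z *~ (-1) ^+ n : cochain M k) = (z : cochain M k) *~ (-1) ^+ n.
Proof.
rewrite -/(sgn n z) -/(sgn n (cocycle_val z)) !sgnE.
by case: odd.
Qed.

Lemma coho_class_surj (M : bimodule X) k (x : cohomology M k) :
  exists z, x = coho_class z.
Proof. by exists (generic_quotient.repr x); rewrite /coho_class reprK. Qed.

Lemma coho_class_gcast (M : bimodule X) k l (e : k = l)
    (z : cocycles M k) (z' : cocycles M l) :
    gcast (A := cochain M) e z = z' ->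
  gcast (A := cohomology M) e (coho_class z) = coho_class z'.
Proof.
by case: l / e z' => z' zz'; congr coho_class; apply: val_inj.
Qed.

Lemma gcast_cocycle (M : bimodule X) k l (e : k = l) (z : cocycles M k) :
  exists z' : cocycles M l, gcast (A := cochain M) e z = z'.
Proof. by case: l / e; exists z. Qed.

(** * The product on cohomology *)

Section Product.
Variable M : bimoduleAlgebra X.

Lemma smile_cocycle p q (f : cocycles M p) (g : cocycles M q) :
  smile f g \in @cocycle X M (p + q).
Proof.
have [_ _ _ leibniz] := cochain_dg_algebra M.
rewrite unfold_in leibniz !diff_cocycle.
have [smileDl smileDr _] := cochain_graded_algebra M.
have -> : smile (0 : cochain M p.+1) g = 0.
  by apply: (addIr (smile (0 : cochain M p.+1) g)); rewrite -smileDl !add0r.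
have -> : smile f (0 : cochain M q.+1) = 0.
  by apply: (addIr (smile f (0 : cochain M q.+1))); rewrite -smileDr !add0r.
have -> k l (e : k = l) : gcast (A := cochain M) e 0 = 0 by case: l / e.
by rewrite mul0rz addr0.
Qed.

Definition smilez p q (f : cocycles M p) (g : cocycles M q) :
  cocycles M (p + q) := Cocycle (smile_cocycle f g).

Lemma diffw_cocycle k (z : cocycles M k) w : diffw (ext z) w = 0.
Proof. by rewrite -ext_diff diff_cocycle ext0. Qed.

Lemma ext_sgn_size k (f : cochain M k) w :
  sgn (size w) (ext f w) = ext (f *~ (-1) ^+ k) w.
Proof.
rewrite ext_sgn; have [->//|wk] := eqVneq (size w) k.
by rewrite ext_out ?sgn0 //; apply/eqP.
Qed.

Lemma smile_coboundaryl p q (f : cocycles M p) (g : cocycles M q) :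
  is_coboundary (f : cochain M p) -> is_coboundary (smile f g).
Proof.
case/is_coboundaryE => F fF; apply: (is_coboundaryI (F := cup F (ext g))) => w _.
rewrite diffw_cup ext_smile [X in _ + X](_ : _ = 0) ?addr0.
  exact: eq_cup.
by rewrite /cup shsum0 // => a b _; rewrite diffw_cocycle bmul0r.
Qed.

Lemma smile_coboundaryr p q (f : cocycles M p) (g : cocycles M q) :
  is_coboundary (g : cochain M q) -> is_coboundary (smile f g).
Proof.
case/is_coboundaryE => G gG.
(* The sign in this witness compensates that of the Leibniz rule. *)
apply: (is_coboundaryI (F := cup (fun a => sgn (size a) (ext f a)) G)) => w _.
rewrite diffw_cup ext_smile [X in X + _](_ : _ = 0) ?add0r.
  by apply: eq_cup => // a; rewrite sgnK.
rewrite /cup shsum0 // => a b _.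
rewrite (@eq_in_diffw _ _ (ext ((f *~ (-1) ^+ p : cocycles M p) : cochain M p))).
  by rewrite diffw_cocycle bmul0l.
by move=> c _; rewrite ext_sgn_size cocycle_val_sgn.
Qed.

Definition mulH p q (x : cohomology M p) (y : cohomology M q) :
  cohomology M (p + q) :=
  coho_class (smilez (generic_quotient.repr x) (generic_quotient.repr y)).

Lemma smilezDl p q (f f' : cocycles M p) (g : cocycles M q) :
  smilez (f + f') g = smilez f g + smilez f' g.
Proof.
have [smileDl _ _] := cochain_graded_algebra M.
by apply: val_inj; apply: smileDl.
Qed.

Lemma smilezDr p q (f : cocycles M p) (g g' : cocycles M q) :
  smilez f (g + g') = smilez f g + smilez f g'.
Proof.
have [_ smileDr _] := cochain_graded_algebra M.
by apply: val_inj; apply: smileDr.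
Qed.

Lemma smilezBl p q (f f' : cocycles M p) (g : cocycles M q) :
  smilez (f - f') g = smilez f g - smilez f' g.
Proof. by apply/eqP; rewrite eq_sym subr_eq -smilezDl subrK. Qed.

Lemma smilezBr p q (f : cocycles M p) (g g' : cocycles M q) :
  smilez f (g - g') = smilez f g - smilez f g'.
Proof. by apply/eqP; rewrite eq_sym subr_eq -smilezDr subrK. Qed.

(** Representatives are changed in one factor at a time, each change altering the product by a
    coboundary. *)
Lemma mulHE p q (f : cocycles M p) (g : cocycles M q) :
  mulH (coho_class f) (coho_class g) = coho_class (smilez f g).
Proof.
rewrite /mulH; set f' := generic_quotient.repr _; set g' := generic_quotient.repr _.
have f'f : coho_class f' = coho_class f by rewrite /coho_class reprK.
have g'g : coho_class g' = coho_class g by rewrite /coho_class reprK.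
transitivity (coho_class (smilez f g')).
  apply/coho_class_eqP; rewrite -smilezBl; apply: smile_coboundaryl.
  exact/coho_class_eqP.
apply/coho_class_eqP; rewrite -smilezBr; apply: smile_coboundaryr.
exact/coho_class_eqP.
Qed.

Lemma mulH_induced : induced_product (M := M) mulH.
Proof. by move=> p q f g; exists (smilez f g) => //; apply: mulHE. Qed.

Lemma mulH_graded_algebra : graded_algebra (A := cohomology M) mulH.
Proof.
split=> [p q y x x'|p q x y y'|p q r x y z].
- have [f ->] := coho_class_surj x; have [f' ->] := coho_class_surj x'.
  have [g ->] := coho_class_surj y.
  by rewrite -coho_classD !mulHE smilezDl coho_classD.
- have [f ->] := coho_class_surj x; have [g ->] := coho_class_surj y.
  have [g' ->] := coho_class_surj y'.
  by rewrite -coho_classD !mulHE smilezDr coho_classD.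
have [f ->] := coho_class_surj x; have [g ->] := coho_class_surj y.
have [h ->] := coho_class_surj z.
rewrite !mulHE; apply: coho_class_gcast.
by have [_ _ smileA] := cochain_graded_algebra M; apply: smileA.
Qed.

End Product.

(** An induced product is computed on cocycles, where the defect of commutativity is the coboundary
    of minus the cup-1 product of [f] and [g]. *)
Lemma induced_product_graded_comm (K : comPzRingType) (M := trivial_algebra X K)
    (mul : forall p q,
       cohomology M p -> cohomology M q -> cohomology M (p + q)%N) :
    induced_product mul -> forall p q (f : cocycles M p) (g : cocycles M q),
  mul p q (coho_class f) (coho_class g) =
  gcast (A := cohomology M) (addnC q p)
    (mul q p (coho_class g) (coho_class f)) *~ (-1) ^+ (p * q).
Proof.
move=> ind p q f g; have [h hE ->] := ind p q f g; have [h' h'E ->] := ind q p g f.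
have [h'' h''E] := gcast_cocycle (addnC q p) h'.
rewrite (coho_class_gcast h''E) -coho_class_sgn; apply/coho_class_eqP.
pose F : seq X -> K := cup1 (ext f) (ext g).
apply: (@is_coboundaryI M (p + q) _ (fun a => - F a)) => w _.
have -> : diffw (M := M) (fun a => - F a) w = - diffw (M := M) F w.
  rewrite !diffw_trivial -sumrN; apply: eq_bigr => i _.
  by rewrite -sgnN opprB opprK addrC.
rewrite diffw_cup1 => [|a|a]; try exact: diffw_cocycle.
rewrite -[ext _ w]/(ext (cocycle_val h - cocycle_val (h'' *~ (-1) ^+ (p * q))) w).
rewrite extD extN cocycle_val_sgn ext_sgn -h''E ext_gcast hE h'E !ext_smile opprB.
congr (_ - _); rewrite -shsum_sgn; apply: eq_shsum => a b.
have [->|aq] := eqVneq (size a) q; last first.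
  by rewrite (@ext_out _ _ _ g) ?bmul0l ?mulr0 ?sgn0 //; apply/eqP.
have [->|bp] := eqVneq (size b) p; last first.
  by rewrite (@ext_out _ _ _ f) ?bmul0r ?mul0r ?sgn0 //; apply/eqP.
by rewrite mulnC /= mulrC.
Qed.

End Cohomology.

Theorem theorem3 (X : braidedSet) :
  (forall M : bimoduleAlgebra X,
     dg_algebra (A := cochain M) (@diff X M) (@smile X M) /\
     exists mulH : forall p q,
         cohomology M p -> cohomology M q -> cohomology M (p + q)%N,
       induced_product mulH /\ graded_algebra (A := cohomology M) mulH) /\
  (forall (K : comPzRingType) (M := trivial_algebra X K)
     (mulH : forall p q,
        cohomology M p -> cohomology M q -> cohomology M (p + q)%N),
     induced_product mulH ->
     forall p q (f : cocycles M p) (g : cocycles M q),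
       mulH p q (coho_class f) (coho_class g) =
       gcast (A := cohomology M) (addnC q p)
         (mulH q p (coho_class g) (coho_class f)) *~ (-1) ^+ (p * q)).
Proof.
split=> [M|K M]; last exact: induced_product_graded_comm.
split; first exact: cochain_dg_algebra.
by exists (@mulH X M); split; [apply: mulH_induced|apply: mulH_graded_algebra].
Qed.
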